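(* Let $p_0$ be the true density of a single observation, let $\pi$ be a prior supported on a set $\mathcal{P}$ of densities, and let $p=p^{(n)}$, $n=1,2,\dots$, be a posterior sequence of random densities for iid data. Let $u\in\{1/2,1/3,1/4,\dots\}$ and $0<t<\infty$. Then, with probability $1$, for all sufficiently large sample sizes $n$, $$d_{-u}^2(p_0,p^{(n)})\le d_t^2(p_0,\pi)+n^{-1}\ln\left[N_u(\pi)\,n^{2(u^{-1}+t^{-1})}\right],$$ where $d_t^2(p_0,\pi)=\inf_{K\subset\mathcal{P}}\left[\sup_{q\in K}d_t^2(p_0,q)+n^{-1}\ln(1/\pi(K))\right]$ and $N_u(\pi)$ is the $\ell_u$-norm complexity of the prior $\pi$, i.e. the infimum of $\left[\sum_{j\in\mathcal{N}}\pi(B_j)^u\right]^{1/u}$ over all countable covers $\bigcup_{j\in\mathcal{N}}B_j$ of $\mathcal{P}$ in which each $B_j$ is an $L_1$ ball of radius $n^{-1/u}$.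
   Context: All densities are probability densities of a single observation $Y$ with respect to a common dominating measure. All sets to which $\pi$ is applied are measurable. An $L_1$ ball of radius $r$ is a ball in the set of densities for the distance $\int|f-g|$. Both $N_u(\pi)$ and $d_t^2(p_0,\pi)$ depend on $n$; covers may use infinitely (countably) many balls, and $N_u(\pi)=+\infty$ if no suitable cover has a finite sum (the bound is then trivial). In $d_t^2(p_0,\pi)$, sets with $\pi(K)=0$ contribute $+\infty$. Divergence: for $t>-1$, $t\ne0$, and densities $p,q$, $d_t^2(p,q)=t^{-1}\int p\left((p/q)^t-1\right)$, i.e. $1+t\,d_t^2(p,q)=\int p^{1+t}q^{-t}$ (for $t>0$ this is $+\infty$ if $q=0$ on a set of positive $p$-probability; points with $p=0$ contribute $0$). Posterior sequence of random densities for iid data: a sequence $p^{(n)}$ (labeled by the sample size $n$) of random density functions in $\mathcal{P}$, defined on one probability space, such that for every $n$ and every subset $A\subset\mathcal{P}$, $$\Pr\left[p^{(n)}\in A\right]=\int\left[\frac{\int_{f\in A}\prod_{i=1}^nf(Y_i)\,\pi(df)}{\int_{f\in\mathcal{P}}\prod_{i=1}^nf(Y_i)\,\pi(df)}\right]\prod_{i=1}^np_0(Y_i)\,dY_i ,$$ the ratio being assumed well defined almost surely. That is, for each $n$, $p^{(n)}$ is marginally distributed as a draw from the posterior given $n$ iid observations from $p_0$; nothing is assumed about the joint law across different $n$. *)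

(* Defs.v *)
From HB Require Import structures.
From mathcomp Require Import all_boot all_order all_algebra.
From mathcomp Require Import all_classical all_reals all_analysis.

Set Implicit Arguments.
Unset Strict Implicit.
Unset Printing Implicit Defensive.

Import Order.TTheory GRing.Theory Num.Theory.
Import numFieldNormedType.Exports.

Local Open Scope classical_set_scope.
Local Open Scope ring_scope.
Local Open Scope ereal_scope.

Section densities.
Context (d : measure_display) (T : measurableType d) (R : realType).
Variable mu : {measure set T -> \bar R}.

Definition is_density (f : T -> R) : Prop :=
  [/\ measurable_fun setT f,
      forall y, (0 <= f y)%R &
      \int[mu]_y (f y)%:E = 1].

(* (a / b)^t for a, b >= 0 and t <> 0; its value at a = b = 0 is irrelevant
   below, where it is multiplied by a. The case b = 0 is separate because
   [poweR] sends +oo to +oo for negative exponents too. *)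
Definition ratio_pow (t a b : R) : \bar R :=
  if (b == 0)%R then (if (0 < t)%R then +oo else 0) else ((a / b) `^ t)%:E.

(* d_t^2(p, q), for t > -1 and t <> 0 *)
Definition divergence (t : R) (p q : T -> R) : \bar R :=
  (t^-1)%:E * \int[mu]_y ((p y)%:E * (ratio_pow t (p y) (q y) - 1)).

Definition L1_ball (f : T -> R) (r : R) : set (T -> R) :=
  [set g | is_density g /\ \int[mu]_y `|f y - g y|%:E < r%:E].

(* The integral with respect to dY_1 ... dY_n, as an iterated integral. It is
   only applied to nonnegative functions of the form F(Y) * \prod_i p0(Y_i),
   for which the order of integration does not matter, even when mu is not
   sigma-finite, since the density p0 makes the reference measure finite. *)
Fixpoint sample_integral (n : nat) : (n.-tuple T -> \bar R) -> \bar R :=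
  match n with
  | 0 => fun F => F [tuple]
  | n'.+1 => fun F =>
      \int[mu]_y sample_integral (fun Y : n'.-tuple T => F (cons_tuple y Y))
  end.

Definition likelihood (n : nat) (f : T -> R) (Y : n.-tuple T) : R :=
  (\prod_(i < n) f (tnth Y i))%R.

(* An arbitrary sigma-algebra on densities is presented as the one generated by
   a family G of sets of functions (G may itself be a sigma-algebra). *)
Variables (G : set (set (T -> R))) (pi : probability (g_sigma_algebraType G) R).
Variable PP : set (T -> R).

(* Sets in the sigma-algebra outside PP play no role: only measurable subsets
   of PP are ever measured by pi. *)
Definition prior_on : Prop :=
  [/\ G.-sigma.-measurable PP,
      pi PP = 1,
      PP `<=` is_density &
      measurable_fun (PP `*` setT : set (g_sigma_algebraType G * T))
        (fun x : g_sigma_algebraType G * T => (x.1 : T -> R) x.2)].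

Definition marginal_likelihood (A : set (T -> R)) (n : nat) (Y : n.-tuple T)
    : \bar R :=
  \int[pi]_(f in (A : set (g_sigma_algebraType G))) (likelihood f Y)%:E.

Definition posterior (A : set (T -> R)) (n : nat) (Y : n.-tuple T) : \bar R :=
  marginal_likelihood A Y / marginal_likelihood PP Y.

Definition posterior_well_defined (p0 : T -> R) (n : nat) : Prop :=
  sample_integral (fun Y : n.-tuple T =>
    (\1_(~` [set Z : n.-tuple T | (0 < marginal_likelihood PP Z < +oo)%E]) Y)%:E
    * (likelihood p0 Y)%:E) = 0.

Definition posterior_sequence (p0 : T -> R) (d' : measure_display)
    (Omega : measurableType d') (Pr : probability Omega R)
    (p : nat -> Omega -> T -> R) : Prop :=
  forall n : nat, (0 < n)%N ->
  [/\ posterior_well_defined p0 n,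
      forall w, PP (p n w),
      measurable_fun setT (p n : Omega -> g_sigma_algebraType G) &
      forall A : set (T -> R), G.-sigma.-measurable A -> A `<=` PP ->
        Pr (p n @^-1` A) =
        sample_integral (fun Y : n.-tuple T =>
          posterior A Y * (likelihood p0 Y)%:E)].

(* d_t^2(p0, pi). Sets K with pi K = 0 contribute +oo and are left out of the
   infimum explicitly; for K = set0 the sum below would be -oo + +oo = -oo. *)
Definition prior_divergence (t : R) (p0 : T -> R) (n : nat) : \bar R :=
  ereal_inf [set v | exists K : set (T -> R),
    [/\ G.-sigma.-measurable K, K `<=` PP, 0 < pi K &
        v = ereal_sup [set divergence t p0 q | q in K]
            + (n%:R^-1)%:E * lne (pi K)^-1]].

(* N_u(pi): countable covers are indexed by a subset J of nat, which allows
   finite ones; the centres are arbitrary densities, not only members of PP. *)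
Definition norm_complexity (u : R) (n : nat) : \bar R :=
  let B c : set (T -> R) := L1_ball c (n%:R `^ (- u^-1))%R in
  ereal_inf [set v | exists (J : set nat) (c : nat -> T -> R),
    [/\ forall j, J j -> is_density (c j),
        forall j, J j -> G.-sigma.-measurable (PP `&` B (c j)),
        PP `<=` \bigcup_(j in J) B (c j) &
        v = (\esum_(j in J) (pi (PP `&` B (c j))) `^ u) `^ u^-1]].

End densities.

(* Main.v *)
Require Import Defs.
From HB Require Import structures.
From mathcomp Require Import all_boot all_order all_algebra.
From mathcomp Require Import all_classical all_reals all_analysis.
From mathcomp Require Import measurable_realfun ring lra.

Set Implicit Arguments.
Unset Strict Implicit.
Unset Printing Implicit Defensive.

Import Order.TTheory GRing.Theory Num.Theory.
Import numFieldNormedType.Exports.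

Local Open Scope classical_set_scope.
Local Open Scope ring_scope.
Local Open Scope ereal_scope.

(** Let A be the set of densities violating the bound and split A into
    disjoint pieces C_j, each inside one L_1 ball of radius n^(-1/u). Write L_f
    for the likelihood of f. Pointwise in the sample, for every M > 0, the
    posterior mass of A times L_p0 is at most
      M^u \sum_j L_p0^(1-u) (\int_(C_j) L_f dpi)^u
        + const * \int_K L_p0 (L_p0 / L_f)^t dpi:
    if L_p0 <= M \int L_f dpi, use x <= x^u for the posterior mass x of each
    C_j; otherwise L_p0 itself is bounded by the last term, Markov's inequality
    giving a part of K of mass pi(K)/2 on which L_f is small.

    Integrating out one observation at a time, the first summands decrease by
    the factor 1 - u eps + 2^u/n: a mixture of members of C_j is within
    2 n^(-1/u) in L_1 of a member of A, and f |-> \int p0^(1-u) f^u moves by at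
    most the u-th power of that distance. The last term grows by
    1 + t d_t^2(p0, f). With M of order n^(2/t) exp(n sup_K d_t^2) / pi(K) the
    expected posterior mass of A is O(n^(-2)), and Borel-Cantelli concludes. *)

(** * Iterated integrals of nonnegative functions *)

Lemma le_nonneg_integral d (T : measurableType d) (R : realType)
    (mu : {measure set T -> \bar R}) (f g : T -> \bar R) :
  (forall x, 0 <= f x) -> (forall x, f x <= g x) ->
  \int[mu]_x f x <= \int[mu]_x g x.
Proof.
move=> f0 fg; have g0 x : 0 <= g x by exact: le_trans (fg x).
(* A nonnegative integral is a supremum over simple functions below the integrand, so monotonicity
   is immediate. This covers the inner functions of [sample_integral], whose measurability is not
   known. *)
rewrite !ge0_integralTE//; apply: le_ereal_sup => _ [h hf <-].
by exists h => // x; exact: le_trans (hf x) (fg x).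
Qed.

Lemma sample_integral_ge0 d (T : measurableType d) (R : realType)
    (mu : {measure set T -> \bar R}) n (F : n.-tuple T -> \bar R) :
  (forall Y, 0 <= F Y) -> 0 <= sample_integral mu F.
Proof.
elim: n F => [|n IH] F F0 /=; first exact: F0.
by apply: integral_ge0 => y _; apply: IH.
Qed.

Lemma le_sample_integral d (T : measurableType d) (R : realType)
    (mu : {measure set T -> \bar R}) n (F H : n.-tuple T -> \bar R) :
  (forall Y, 0 <= F Y) -> (forall Y, F Y <= H Y) ->
  sample_integral mu F <= sample_integral mu H.
Proof.
elim: n F H => [|n IH] F H F0 FH /=; first exact: FH.
apply: le_nonneg_integral => y; first exact: sample_integral_ge0.
exact: IH.
Qed.

Lemma likelihood0 d (T : measurableType d) (R : realType) (f : T -> R)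
  (Y : 0.-tuple T) : likelihood f Y = 1%R.
Proof. by rewrite /likelihood big_ord0. Qed.

Lemma likelihood_cons d (T : measurableType d) (R : realType) (f : T -> R) n
    (y : T) (Y : n.-tuple T) :
  likelihood f (cons_tuple y Y) = (f y * likelihood f Y)%R.
Proof.
rewrite /likelihood big_ord_recl /=; congr (_ * _)%R.
by apply: eq_bigr => i _; rewrite tnthS.
Qed.

Lemma likelihood_ge0 d (T : measurableType d) (R : realType) (f : T -> R) n
  (Y : n.-tuple T) : (forall y, 0 <= f y)%R -> (0 <= likelihood f Y)%R.
Proof. by move=> f0; apply: prodr_ge0. Qed.

(* The iterated integral of a functional of the final state is controlled by
   one-step bounds, without any measurability on the space of samples. *)
Lemma sample_integral_supermartingale d (T : measurableType d) (R : realType)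
    (mu : {measure set T -> \bar R}) (X : Type) (ok : X -> Prop)
    (act : X -> T -> X) (Phi : nat -> X -> \bar R) :
  (forall x y, ok x -> ok (act x y)) ->
  (forall k x, ok x -> 0 <= Phi k x) ->
  (forall k x, ok x -> \int[mu]_y Phi k (act x y) <= Phi k.+1 x) ->
  forall n x, ok x ->
    sample_integral mu (fun Y : n.-tuple T => Phi 0%N (foldl act x Y))
    <= Phi n x.
Proof.
move=> okact Phi0 step; elim=> [|n IH] x okx //=.
apply: le_trans (step n x okx).
apply: le_nonneg_integral => y; last by apply: IH; exact: okact.
apply: sample_integral_ge0 => Y; apply: Phi0.
have := okact _ y okx; elim: (Y : seq T) (act x y) => //= z s IHs x' okx'.
by apply: IHs; exact: okact.
Qed.

(** * Tonelli for integrands vanishing where p0 does *)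

Section reference_measure.
Context d (T : measurableType d) (R : realType).
Variables (mu : {measure set T -> \bar R}) (p0 : T -> R).
Hypothesis p0_density : is_density mu p0.

Let mp0 : measurable_fun setT p0. Proof. by case: p0_density. Qed.

Let S : set T := [set y | (p0 y != 0)%R].

Let mS : measurable S.
Proof.
rewrite (_ : S = setT `&` p0 @^-1` (~` [set 0%R])).
  exact: (mp0 measurableT (measurableC (measurable_set1 _))).
by rewrite setTI; apply/seteqP; split => x /eqP.
Qed.

Let muS := mrestr mu mS.

(** By Markov's inequality the level set where p0 >= 1/(k+1) has mu-measure at most k+1, since p0
    integrates to 1. These sets exhaust [S], and the complement of [S] is null for [muS]. *)
Let muS_sigma_finite : sigma_finite setT muS.
Proof.
have [_ p0_ge0 p0_1] := p0_density.
pose F (k : nat) := ~` S `|` [set y | (k.+1%:R^-1 <= p0 y)%R].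
have mF k : measurable [set y | (k.+1%:R^-1 <= p0 y)%R].
  rewrite -[X in measurable X]setTI.
  rewrite [X in measurable (_ `&` X)](_ : _ = p0 @^-1` `[k.+1%:R^-1%R, +oo[%classic).
    exact: mp0.
  by apply/seteqP; split => y /=; rewrite in_itv/= andbT.
exists F.
  apply/seteqP; split => // y _.
  have [y0|y0] := eqVneq (p0 y) 0%R.
    by exists 0%N => //; left => /=; rewrite /S /= y0 eqxx.
  have py : (0 < p0 y)%R by rewrite lt0r y0 p0_ge0.
  exists (Num.truncn (p0 y)^-1) => //; right => /=.
  rewrite -[leRHS]invrK lef_pV2 ?posrE ?invr_gt0 //.
  by apply: ltW; exact: truncnS_gt.
move=> k; split.
  by apply: measurableU; [exact: measurableC|exact: mF].
rewrite /muS /mrestr setIUl setICl set0U.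
have le1 : mu ([set y | (k.+1%:R^-1 <= p0 y)%R] `&` S) <=
    mu [set y | (k.+1%:R^-1 <= p0 y)%R].
  by apply: le_measure; rewrite ?inE//; exact: measurableI.
apply: le_lt_trans le1 _.
have mEp0 : measurable_fun setT (fun y => (p0 y)%:E) by exact/measurable_EFinP.
have k0 :  (0 < k.+1%:R^-1 :> R)%R by rewrite invr_gt0.
have := le_integral_abse mu measurableT mEp0 k0.
rewrite setTI.
have -> : \int[mu]_x `|(p0 x)%:E| = 1.
  by rewrite -p0_1; apply: eq_integral => x _; rewrite abse_EFin ger0_norm.
have -> : [set x | ((k.+1%:R^-1)%R)%:E <= `|(p0 x)%:E|] =
          [set y | (k.+1%:R^-1 <= p0 y)%R].
  by apply/seteqP; split => x /=; rewrite lee_fin ger0_norm.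
move=> h; have : (k.+1%:R)%:E * ((k.+1%:R^-1)%:E *
    mu [set y | (k.+1%:R^-1 <= p0 y)%R]) <= (k.+1%:R)%:E * 1.
  by apply: lee_wpmul2l => //; rewrite lee_fin.
rewrite muleA -EFinM mulfV ?pnatr_eq0// mul1e mule1.
by move/le_lt_trans; apply; exact: ltry.
Qed.

(** The measure [nu] is [mu] restricted to the set where p0 is nonzero; an integrand vanishing off
    that set has the same integral under both. *)
Lemma density_reference_measure :
  exists nu : {sigma_finite_measure set T -> \bar R},
    forall f : T -> \bar R, (forall y, p0 y = 0%R -> f y = 0) ->
      \int[mu]_y f y = \int[nu]_y f y.
Proof.
pose nu : {sigma_finite_measure set T -> \bar R} :=
  HB.pack (muS : set T -> \bar R) (Measure.on (mrestr mu mS))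
    (@Measure_isSigmaFinite.Build _ T R muS muS_sigma_finite).
exists nu => f fS; have fE : f \_ S = f.
  apply/funext => y; rewrite patchE; case: ifPn => //.
  by rewrite notin_setE /S /= => /negP; rewrite negbK => /eqP /fS.
rewrite -fE -!integral_mkcond; apply: eq_measure_integral => A mA AS.
by transitivity (mu (A `&` S)) => //; rewrite setIidl.
Qed.

Context dH (H : measurableType dH) (pi : probability H R).
Variable F : H * T -> \bar R.
Hypotheses (mF : measurable_fun setT F) (F0 : forall z, 0 <= F z)
  (FS : forall h y, p0 y = 0%R -> F (h, y) = 0).

(* The reference measure need not be sigma-finite, but it is so on the set
   where p0 > 0. *)
Lemma tonelli_density :
  \int[mu]_y \int[pi]_h F (h, y) = \int[pi]_h \int[mu]_y F (h, y).
Proof.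
have [nu integral_nu] := density_reference_measure.
rewrite integral_nu; last first.
  by move=> y y0; apply: integral0_eq => h _; exact: FS.
rewrite -(@fubini_tonelli _ _ _ _ _ pi nu)//.
by apply: eq_integral => h _; rewrite integral_nu// => y; exact: FS.
Qed.

Lemma measurable_integral_density :
  measurable_fun setT (fun h => \int[mu]_y F (h, y)).
Proof.
have [nu integral_nu] := density_reference_measure.
have := @measurable_fun_fubini_tonelli_F _ _ _ _ _ nu F mF F0.
congr (measurable_fun _ _).
by apply/funext => h; rewrite /fubini_F -integral_nu// => y; exact: FS.
Qed.

End reference_measure.

Lemma measurable_fun_integral_in d (T : measurableType d) (R : realType)
    dH (H : measurableType dH) (pi : probability H R) (F : H * T -> \bar R)
    (C : set H) : measurable C ->
  measurable_fun setT F -> (forall z, 0 <= F z) ->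
  measurable_fun setT (fun y => \int[pi]_(h in C) F (h, y)).
Proof.
move=> mC mF F0; have mCT : measurable (C `*` @setT T) by exact: measurableX.
have -> : (fun y => \int[pi]_(h in C) F (h, y)) =
    fubini_G pi (F \_ (C `*` setT)).
  apply/funext => y; rewrite /fubini_G [LHS]integral_mkcond.
  apply: eq_integral => h _; rewrite !patchE.
  by congr (if _ then _ else _); apply/idP/idP; rewrite !inE//= => -[].
apply: measurable_fun_fubini_tonelli_G.
  by apply/(measurable_restrict F mCT measurableT); rewrite setTI; exact: measurable_funTS.
by move=> z; rewrite patchE; case: ifP.
Qed.

Lemma tonelli_density_in d (T : measurableType d) (R : realType)
    (mu : {measure set T -> \bar R}) (p0 : T -> R) (p0_density : is_density mu p0)
    dH (H : measurableType dH) (pi : probability H R) (F : H * T -> \bar R)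
    (C : set H) : measurable C ->
  measurable_fun setT F -> (forall z, 0 <= F z) ->
  (forall h y, p0 y = 0%R -> F (h, y) = 0) ->
  \int[mu]_y \int[pi]_(h in C) F (h, y) =
  \int[pi]_(h in C) \int[mu]_y F (h, y).
Proof.
move=> mC mF F0 FS; have mCT : measurable (C `*` @setT T) by exact: measurableX.
pose F' := F \_ (C `*` setT).
have F'E h y : F' (h, y) = ((fun h => F (h, y)) \_ C) h.
  rewrite /F' !patchE.
  by congr (if _ then _ else _); apply/idP/idP; rewrite !inE//= => -[].
transitivity (\int[mu]_y \int[pi]_h F' (h, y)).
  apply: eq_integral => y _; rewrite [LHS]integral_mkcond.
  by apply: eq_integral => h _; rewrite F'E.
rewrite (tonelli_density p0_density).
- rewrite [RHS]integral_mkcond; apply: eq_integral => h _; rewrite patchE.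
  case: ifPn => hC.
    by apply: eq_integral => y _; rewrite F'E patchE hC.
  by apply: integral0_eq => y _; rewrite F'E patchE (negbTE hC).
- by apply/(measurable_restrict F mCT measurableT); rewrite setTI; exact: measurable_funTS.
- by move=> z; rewrite /F' patchE; case: ifP.
- by move=> h y y0; rewrite F'E patchE FS//; case: ifP.
Qed.

(** * One-observation bounds *)

(** For 0 <= x <= a + b, the ratio x/(a+b) lies in [0, 1] and is therefore at most its u-th power.
    Multiplying by (a+b)^u and adding the cases x = a and x = b gives the claim. *)
Lemma powR_subadditive (R : realType) (a b u : R) :
  (0 <= a -> 0 <= b -> 0 < u -> u <= 1 ->
   (a + b) `^ u <= a `^ u + b `^ u)%R.
Proof.
move=> a0 b0 u0 u1.
have [s0|s0] := eqVneq (a + b)%R 0%R.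
  by rewrite s0 powR0 ?gt_eqF// addr_ge0 ?powR_ge0.
have sp : (0 < a + b)%R by rewrite lt0r s0 addr_ge0.
have key x : (0 <= x -> x <= a + b ->
    x / (a + b) * (a + b) `^ u <= x `^ u)%R.
  move=> x0 xs; have [->|xn0] := eqVneq x 0%R.
    by rewrite !mul0r powR_ge0.
  have xp : (0 < x)%R by rewrite lt0r xn0.
  have h : (x / (a + b) <= (x / (a + b)) `^ u)%R.
    apply: ger1_powR => //; rewrite divr_gt0//=.
    by rewrite ler_pdivrMr// mul1r.
  apply: le_trans (ler_wpM2r (powR_ge0 (a + b) u) h) _.
  rewrite -powRM ?divr_ge0// ?(ltW sp)//.
  by rewrite divfK.
have -> : ((a + b) `^ u = a / (a + b) * (a + b) `^ u
                          + b / (a + b) * (a + b) `^ u)%R.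
  by rewrite -mulrDl -mulrDl divff// mul1r.
by apply: lerD; apply: key => //; rewrite ?lerDl ?lerDr.
Qed.

(** Young's inequality for a^(1-u) and b^u with the conjugate exponents 1/(1-u) and 1/u. *)
Lemma weighted_am_gm (R : realType) (a b u : R) :
  (0 <= a -> 0 <= b -> 0 < u -> u < 1 ->
   a `^ (1 - u) * b `^ u <= (1 - u) * a + u * b)%R.
Proof.
move=> a0 b0 u0 u1.
have v0 : (0 < 1 - u)%R by rewrite subr_gt0.
have := @conjugate_powR R (a `^ (1 - u))%R (b `^ u)%R ((1 - u)^-1)%R (u^-1)%R
  (powR_ge0 _ _) (powR_ge0 _ _).
rewrite !invr_gt0 => /(_ v0 u0); rewrite !invrK subrK => /(_ erefl).
rewrite -!powRrM divff ?gt_eqF// divff ?gt_eqF// !powRr1//.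
by rewrite [(a * _)%R]mulrC [(b * _)%R]mulrC.
Qed.

Lemma ratio_pow_ge0 (R : realType) (t a b : R) : 0 <= ratio_pow t a b.
Proof.
rewrite /ratio_pow; case: ifP => _; last by rewrite lee_fin powR_ge0.
by case: ifP.
Qed.

(** This multiplicativity lets the factor of one observation be split off in [inverse_power]. If a
    and a' are positive and b or b' is zero, both sides are +oo, because the remaining factor is
    strictly positive. *)
Lemma ratio_pow_mul (R : realType) (t a b a' b' : R) : (0 < t)%R ->
  (0 <= a)%R -> (0 <= b)%R -> (0 <= a')%R -> (0 <= b')%R ->
  (a * a')%:E * ratio_pow t (a * a') (b * b') =
  (a%:E * ratio_pow t a b) * (a'%:E * ratio_pow t a' b').
Proof.
move=> t0 a0 b0 a'0 b'0.
have [->|an0] := eqVneq a 0%R; first by rewrite !mul0r !mul0e.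
have [->|a'n0] := eqVneq a' 0%R; first by rewrite !mulr0 !mul0e mule0.
have ap : (0 < a)%R by rewrite lt0r an0.
have a'p : (0 < a')%R by rewrite lt0r a'n0.
have pos c e : (0 < c)%R -> (0 <= e)%R -> 0 < c%:E * ratio_pow t c e.
  move=> c0 e0; rewrite /ratio_pow t0; case: ifPn => en0.
    by rewrite gt0_muley// lte_fin.
  by rewrite lte_fin mulr_gt0// powR_gt0// divr_gt0// lt0r en0.
have ratio0 c : ratio_pow t c 0 = +oo by rewrite /ratio_pow eqxx t0.
have [bE|bn0] := eqVneq b 0%R.
  rewrite bE mul0r !ratio0 !gt0_muley ?lte_fin ?mulr_gt0//.
  by rewrite gt0_mulye// pos.
have [b'E|b'n0] := eqVneq b' 0%R.
  rewrite b'E mulr0 !ratio0 [_%:E * +oo]gt0_muley ?lte_fin ?mulr_gt0//.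
  by rewrite [a'%:E * +oo]gt0_muley ?lte_fin// gt0_muley// pos.
rewrite /ratio_pow mulf_eq0 (negbTE bn0) (negbTE b'n0) /= -!EFinM.
have -> : (a * a' / (b * b') = (a / b) * (a' / b'))%R by rewrite invfM mulrACA.
by congr (_%:E); rewrite powRM ?divr_ge0// mulrACA.
Qed.

Lemma measurable_ratio_pow d (T : measurableType d) (R : realType) (t : R)
    (a b : T -> R) : measurable_fun setT a -> measurable_fun setT b ->
  (forall y, 0 <= b y)%R ->
  measurable_fun setT (fun y => (a y)%:E * ratio_pow t (a y) (b y)).
Proof.
move=> ma mb b0; apply: emeasurable_funM; first exact/measurable_EFinP.
apply: measurable_fun_ifT.
- exact: measurable_fun_eqr.
- exact: measurable_cst.
- apply/measurable_EFinP.
  apply: (measurableT_comp (measurable_powR t)).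
  apply: measurable_funM => //.
  under eq_fun do rewrite -powR_inv1//.
  exact: measurableT_comp (measurable_powR _) mb.
Qed.

(** Subadditivity bounds G^u by (W f)^u + h^u. After rescaling h by W eta, Young's inequality
    replaces p^(1-u) h^u by a combination linear in p and h, whose integrals are under control. The
    bound on G is asked only where p is nonzero: elsewhere the left side vanishes because 1 - u >
    0. *)
Lemma power_split (R : realType) (u c p W f eta : R) (h G : \bar R) :
  (0 < u)%R -> (u < 1)%R -> (0 < c)%R -> (0 <= p)%R -> (0 < W)%R ->
  (0 <= f)%R -> (0 < eta)%R -> 0 <= h -> 0 <= G ->
  (p != 0%R -> G <= (W * f)%:E + h) ->
  ((c * p) `^ (1 - u))%:E * G `^ u <=
    (c `^ (1 - u) * W `^ u * (p `^ (1 - u) * f `^ u))%:E +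
    ((c `^ (1 - u) * W `^ u * eta `^ u * (1 - u) * p)%:E +
     (c `^ (1 - u) * W `^ u * eta `^ u * u / (W * eta))%:E * h).
Proof.
move=> u0 u1 c0 p0 W0 f0 eta0 h0 G0 Gle.
have [c0' W0' eta0' u0'] := And4 (ltW c0) (ltW W0) (ltW eta0) (ltW u0).
have v0 : (0 < 1 - u)%R by rewrite subr_gt0.
have k0 : (0 < c `^ (1 - u) * W `^ u)%R by rewrite mulr_gt0// powR_gt0.
have ke0 : (0 < c `^ (1 - u) * W `^ u * eta `^ u)%R by rewrite mulr_gt0// powR_gt0.
have k3 : (0 < c `^ (1 - u) * W `^ u * eta `^ u * u / (W * eta))%R.
  by rewrite divr_gt0// mulr_gt0.
have pu0 := powR_ge0 p (1 - u); have fu0 := powR_ge0 f u.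
have [->|pn0] := eqVneq p 0%R.
  rewrite mulr0 powR0 ?gt_eqF// mul0e mul0r mulr0 add0e mulr0 add0e.
  by rewrite mule_ge0// lee_fin ltW.
move/(_ pn0) in Gle.
case: h h0 Gle => [r|_ _|//]; last by rewrite gt0_muley// !addey// leey.
rewrite lee_fin => r0; case: G G0 => [g|_ /=|//]; last by rewrite leye_eq.
rewrite lee_fin => g0; rewrite -EFinD lee_fin => gle.
rewrite poweR_EFin -EFinM -EFinM -!EFinD lee_fin.
have step : (g `^ u <= W `^ u * f `^ u + W `^ u * eta `^ u * (r / (W * eta)) `^ u)%R.
  have -> : (W `^ u * eta `^ u * (r / (W * eta)) `^ u = r `^ u)%R.
    rewrite -!powRM ?divr_ge0 ?mulr_ge0//.
    by rewrite mulrC divfK// mulf_neq0// gt_eqF.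
  rewrite -powRM//.
  apply: le_trans (powR_subadditive _ _ u0 (ltW u1)) => //.
    by apply: ge0_ler_powR; rewrite ?nnegrE// addr_ge0// mulr_ge0.
  by rewrite mulr_ge0.
have x0 : (0 <= r / (W * eta))%R by rewrite divr_ge0// mulr_ge0.
have amgm := weighted_am_gm p0 x0 u0 u1.
rewrite powRM//.
have c1 := powR_ge0 c (1 - u).
apply: le_trans (ler_wpM2l (mulr_ge0 c1 pu0) step) _.
have := ler_wpM2l (ltW ke0) amgm.
set P := (p `^ (1 - u))%R; set X := (_ `^ u)%R; set Y := (_ `^ u)%R.
by lra.
Qed.

Section steps.
Context d (T : measurableType d) (R : realType).
Variables (mu : {measure set T -> \bar R}) (p0 : T -> R).
Hypothesis p0_density : is_density mu p0.
Context dH (H : measurableType dH) (pi : probability H R).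
Variable e : H -> T -> R.
Hypotheses (me : measurable_fun setT (fun z : H * T => e z.1 z.2))
  (e0 : forall h y, (0 <= e h y)%R).

(** Here and in [inverse_power], the pair (c, w) is the state after some observations: c is the
    likelihood of p0 so far and w h that of [e h]. *)
Definition weighted_power (u : R) (C : set H) (c : R) (w : H -> R) : \bar R :=
  (c `^ (1 - u))%:E * (\int[pi]_(h in C) (w h)%:E) `^ u.

Definition inverse_power (t : R) (K : set H) (c : R) (w : H -> R) : \bar R :=
  \int[pi]_(h in K) (c%:E * ratio_pow t c (w h)).

Let p0_ge0 y : (0 <= p0 y)%R. Proof. by case: p0_density. Qed.
Let mp0 : measurable_fun setT p0. Proof. by case: p0_density. Qed.

Lemma weighted_power_ge0 u C c w : 0 <= weighted_power u C c w.
Proof. by rewrite mule_ge0 ?lee_fin ?powR_ge0 ?poweR_ge0. Qed.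

Lemma inverse_power_ge0 t K c w : (0 <= c)%R -> 0 <= inverse_power t K c w.
Proof.
by move=> c0; apply: integral_ge0 => h _; rewrite mule_ge0 ?ratio_pow_ge0.
Qed.

Lemma measurable_weighted_power u (C : set H) c (w : H -> R) :
  measurable C -> measurable_fun setT w -> (forall h, 0 <= w h)%R ->
  measurable_fun setT
    (fun y => weighted_power u C (c * p0 y) (fun h => (w h * e h y)%R)).
Proof.
move=> mC mw w0; apply: emeasurable_funM.
  apply/measurable_EFinP; apply: (measurableT_comp (measurable_powR _)).
  exact: measurable_funM.
apply: (measurableT_comp (measurable_poweR u)).
apply: (@measurable_fun_integral_in _ _ _ _ _ pi
  (fun z : H * T => (w z.1 * e z.1 z.2)%:E)) => //.
  apply/measurable_EFinP; apply: measurable_funM => //.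
  exact: measurableT_comp mw measurable_fst.
by move=> z; rewrite lee_fin mulr_ge0.
Qed.

Let inverse_power_kernel t c (w : H -> R) (z : H * T) : \bar R :=
  (c * p0 z.2)%:E * ratio_pow t (c * p0 z.2) (w z.1 * e z.1 z.2).

Let measurable_inverse_power_kernel t c (w : H -> R) :
  measurable_fun setT w -> (forall h, 0 <= w h)%R ->
  measurable_fun setT (inverse_power_kernel t c w).
Proof.
move=> mw w0; apply: (@measurable_ratio_pow _ (H * T)%type R t
  (fun z => c * p0 z.2)%R (fun z => w z.1 * e z.1 z.2)%R).
- apply: measurable_funM => //.
  exact: measurableT_comp mp0 measurable_snd.
- apply: measurable_funM => //.
  exact: measurableT_comp mw measurable_fst.
- by move=> z; rewrite mulr_ge0.
Qed.

Lemma measurable_inverse_power t (K : set H) c (w : H -> R) :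
  measurable K -> (0 <= c)%R -> measurable_fun setT w ->
  (forall h, 0 <= w h)%R ->
  measurable_fun setT
    (fun y => inverse_power t K (c * p0 y) (fun h => (w h * e h y)%R)).
Proof.
move=> mK c0 mw w0; rewrite /inverse_power.
apply: (@measurable_fun_integral_in _ _ _ _ _ pi (inverse_power_kernel t c w)) => //.
  exact: measurable_inverse_power_kernel.
by move=> z; rewrite mule_ge0 ?ratio_pow_ge0// lee_fin mulr_ge0.
Qed.

(** After Tonelli, [ratio_pow_mul] factors the inner integral into the old integrand times an
    integral over one observation, which is at most tau for h in K. *)
Lemma inverse_power_step t tau (K : set H) c (w : H -> R) :
  measurable K -> (0 < t)%R -> (0 <= tau)%R -> (0 <= c)%R ->
  measurable_fun setT w -> (forall h, 0 <= w h)%R ->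
  (forall h, K h ->
    \int[mu]_y ((p0 y)%:E * ratio_pow t (p0 y) (e h y)) <= tau%:E) ->
  \int[mu]_y inverse_power t K (c * p0 y) (fun h => (w h * e h y)%R)
  <= tau%:E * inverse_power t K c w.
Proof.
move=> mK t0 tau0 c0 mw w0 hK; rewrite /inverse_power.
have Q0 h y : 0 <= (p0 y)%:E * ratio_pow t (p0 y) (e h y).
  by rewrite mule_ge0 ?ratio_pow_ge0 ?lee_fin.
have q0 h : 0 <= c%:E * ratio_pow t c (w h).
  by rewrite mule_ge0 ?ratio_pow_ge0.
have mq : measurable_fun setT (fun h => c%:E * ratio_pow t c (w h)).
  exact: (@measurable_ratio_pow _ H R t (fun=> c) w).
have := @tonelli_density_in _ _ _ mu _ p0_density _ _ pi
  (inverse_power_kernel t c w) K mK (measurable_inverse_power_kernel t c mw w0).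
rewrite /inverse_power_kernel /= => ->; first last.
- by move=> h y ->; rewrite mulr0 mul0e.
- by move=> z; rewrite mule_ge0 ?ratio_pow_ge0// lee_fin mulr_ge0.
rewrite -ge0_integralZl//=; last exact: measurable_funTS.
rewrite [leLHS]integral_mkcond [leRHS]integral_mkcond.
apply: le_nonneg_integral => h; rewrite !patchE; case: ifPn => // hK'.
  by apply: integral_ge0 => y _; rewrite mule_ge0 ?ratio_pow_ge0// lee_fin mulr_ge0.
under eq_integral do rewrite ratio_pow_mul//.
rewrite ge0_integralZl//.
  by rewrite muleC; apply: lee_wpmul2r => //; apply: hK; rewrite inE in hK'.
apply: measurable_ratio_pow => //.
exact: (measurableT_comp me (measurable_pair1 h)).
Qed.

(** The affinity bound a is assumed for single members of C only. The mixture with weights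
    proportional to w inherits it up to eta^u, because C has L_1 diameter at most eta. *)
Lemma weighted_power_step u a eta (C : set H) c (w : H -> R) :
  measurable C -> (0 < u)%R -> (u < 1)%R -> (0 <= a)%R -> (0 < eta)%R ->
  (0 <= c)%R -> measurable_fun setT w -> (forall h, 0 <= w h)%R ->
  (forall h, C h -> \int[mu]_y (p0 y `^ (1 - u) * e h y `^ u)%:E <= a%:E) ->
  (forall h h', C h -> C h' ->
    \int[mu]_y `|e h y - e h' y|%:E <= eta%:E) ->
  \int[mu]_y weighted_power u C (c * p0 y) (fun h => (w h * e h y)%R)
  <= (a + eta `^ u)%:E * weighted_power u C c w.
Proof.
move=> mC u0 u1 a0 eta0; rewrite le_eqVlt => /predU1P[<-|c0] mw w0 aff diam.
  rewrite integral0_eq => [|y _]; last first.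
    by rewrite /weighted_power mul0r powR0 ?mul0e// subr_eq0 gt_eqF.
  by apply: mule_ge0; rewrite ?weighted_power_ge0// lee_fin addr_ge0 ?powR_ge0.
have au0 : (0 < a + eta `^ u)%R by rewrite ltr_wpDl// powR_gt0.
have mE : measurable_fun setT (fun h => (w h)%:E) by exact/measurable_EFinP.
have mwe : measurable_fun setT (fun z : H * T => (w z.1 * e z.1 z.2)%R).
  by apply: measurable_funM => //; exact: measurableT_comp mw measurable_fst.
have mey h : measurable_fun setT (e h).
  exact: (measurableT_comp me (measurable_pair1 h)).
have mfe y : measurable_fun setT (fun h => (w h * e h y)%R).
  exact: (measurableT_comp mwe (measurable_pair2 y)).
have We0 : 0 <= \int[pi]_(h in C) (w h)%:E by apply: integral_ge0 => h _; rewrite lee_fin.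
(* With infinite total weight the right side is +oo, since c and a + eta^u are positive. *)
have [|WE] := eqVneq (\int[pi]_(h in C) (w h)%:E) +oo.
  rewrite /weighted_power => ->; rewrite poweRyr ?gt_eqF//.
  by rewrite gt0_muley ?lte_fin ?powR_gt0// gt0_muley ?lte_fin// leey.
(* With zero total weight, w vanishes almost everywhere on C, so every updated weight also
   integrates to zero. *)
have [W0|Wn0] := eqVneq (\int[pi]_(h in C) (w h)%:E) 0.
  rewrite integral0_eq => [|y _]; last first.
    rewrite /weighted_power (_ : \int[pi]_(h in C) _ = 0) ?poweR0r ?mule0 ?gt_eqF//.
    have aew : ae_eq pi C (fun h => (w h)%:E) (cst 0).
      apply/ae_eq_integral_abs => //; first exact: measurable_funTS.
      by rewrite -W0; apply: eq_integral => h _; rewrite abse_EFin ger0_norm.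
    rewrite (ae_eq_integral (cst 0))//; first exact: integral0.
      by apply: measurable_funTS; exact/measurable_EFinP.
    apply: filterS aew => h + Ch => /(_ Ch) [->].
    by rewrite /cst mul0r.
  by apply: mule_ge0; rewrite ?weighted_power_ge0// lee_fin ltW.
have Wfin : \int[pi]_(h in C) (w h)%:E \is a fin_num by rewrite ge0_fin_numE// ltey.
set W := fine (\int[pi]_(h in C) (w h)%:E).
have WEq : \int[pi]_(h in C) (w h)%:E = W%:E by rewrite fineK.
have Wp : (0 < W)%R by rewrite -lte_fin -WEq lt0e Wn0.
have [h0 Ch0] : exists h0, C h0.
  apply: contra_neqP Wn0 => /forallNP C0.
  by rewrite (_ : C = set0) ?integral_set0//; apply/seteqP; split => // h /C0.
(* The indicator of p0 being nonzero makes Tonelli available for [mu]; it is harmless because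
   [power_split] asks for its bound only there. *)
pose F (z : H * T) := (w z.1 * `|e z.1 z.2 - e h0 z.2| * (p0 z.2 != 0)%:R)%:E.
have mF : measurable_fun setT F.
  apply/measurable_EFinP; apply: measurable_funM; first apply: measurable_funM.
  - exact: measurableT_comp mw measurable_fst.
  - apply: measurableT_comp => //; apply: measurable_funB => //.
    exact: measurableT_comp (mey h0) measurable_snd.
  - rewrite (_ : (fun x : H * T => _) =
      (fun x : H * T => if p0 x.2 == 0 then 0 else 1)%R); last first.
      by apply/funext => z; case: eqP.
    apply: measurable_fun_ifT => //; apply: measurable_fun_eqr => //.
    exact: measurableT_comp mp0 measurable_snd.
have F0 z : 0 <= F z by rewrite lee_fin !mulr_ge0.
pose k := (c `^ (1 - u) * W `^ u)%R.
have k0 : (0 < k)%R by rewrite mulr_gt0 ?powR_gt0.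
have ke0 : (0 < k * eta `^ u)%R by rewrite mulr_gt0 ?powR_gt0.
have u1' : (0 <= 1 - u)%R by rewrite subr_ge0 ltW.
pose J y := \int[pi]_(h in C) F (h, y).
have J0 y : 0 <= J y by exact: integral_ge0.
have mJ : measurable_fun setT J by exact: measurable_fun_integral_in.
have maff : measurable_fun setT (fun y => (p0 y `^ (1 - u) * e h0 y `^ u)%R).
  by apply: measurable_funM; apply: (measurableT_comp (measurable_powR _)).
have int_J : \int[mu]_y J y <= (W * eta)%:E.
  rewrite /J (tonelli_density_in p0_density)//; last first.
    by move=> h y y0; rewrite /F /= y0 eqxx mulr0.
  rewrite EFinM -WEq -ge0_integralZr//;
    [|exact: measurable_funTS|by move=> h _; rewrite lee_fin|by rewrite lee_fin ltW].
  - rewrite [leLHS]integral_mkcond [leRHS]integral_mkcond.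
    apply: le_nonneg_integral => h; rewrite !patchE; case: ifPn => // hC.
      exact: integral_ge0.
    apply: (@le_trans _ _ (\int[mu]_y ((w h)%:E * `|e h y - e h0 y|%:E))).
      apply: le_nonneg_integral => // y; rewrite /F /= -EFinM lee_fin.
      by rewrite ler_piMr ?mulr_ge0//; case: (_ != _).
    rewrite ge0_integralZl//.
    + apply: lee_wpmul2l; rewrite ?lee_fin//; apply: diam => //.
      by rewrite inE in hC.
    + apply/measurable_EFinP; apply: measurableT_comp => //.
      exact: measurable_funB.
    + by rewrite lee_fin.
(* With h0 in C, the mixture is at most W e(h0) + J, where J has mu-integral at most W eta. *)
apply: (@le_trans _ _ (\int[mu]_y ((k * (p0 y `^ (1 - u) * e h0 y `^ u))%:E +
   ((k * eta `^ u * (1 - u) * p0 y)%:E + (k * eta `^ u * u / (W * eta))%:E * J y)))).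
  apply: le_nonneg_integral => y; first exact: weighted_power_ge0.
  apply: power_split => //.
    by apply: integral_ge0 => h _; rewrite lee_fin mulr_ge0.
  move=> py; rewrite EFinM -WEq -ge0_integralZr//;
    [|exact: measurable_funTS|by move=> h _; rewrite lee_fin|by rewrite lee_fin].
  rewrite -ge0_integralD//.
  - rewrite [leLHS]integral_mkcond [leRHS]integral_mkcond.
    apply: le_nonneg_integral => h; rewrite !patchE; case: ifPn => // hC.
      by rewrite lee_fin mulr_ge0.
    rewrite /F /= py mulr1 -EFinM -EFinD lee_fin -mulrDr ler_wpM2l//.
    by rewrite -lerBlDl ler_norm.
  - by move=> h _; rewrite -EFinM lee_fin mulr_ge0.
  - apply: measurable_funTS; apply/measurable_EFinP.
    exact: measurable_funM.
  - apply: measurable_funTS.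
    exact: (measurableT_comp mF (measurable_pair2 y)).
rewrite ge0_integralD//; last first.
- apply: emeasurable_funD.
    by apply/measurable_EFinP; exact: measurable_funM.
  exact: emeasurable_funM.
- move=> y _; apply: adde_ge0; first by rewrite lee_fin !mulr_ge0 ?powR_ge0 ?(ltW k0).
  by apply: mule_ge0 => //; rewrite lee_fin divr_ge0 ?mulr_ge0 ?powR_ge0 ?ltW.
- by apply/measurable_EFinP; exact: measurable_funM.
- by move=> y _; rewrite lee_fin !mulr_ge0 ?powR_ge0 ?(ltW k0).
rewrite ge0_integralD//; last first.
- exact: emeasurable_funM.
- by move=> y _; apply: mule_ge0 => //; rewrite lee_fin divr_ge0 ?mulr_ge0 ?powR_ge0 ?ltW.
- by apply/measurable_EFinP; exact: measurable_funM.
- by move=> y _; rewrite lee_fin !mulr_ge0 ?powR_ge0 ?(ltW k0).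
under eq_integral do rewrite EFinM.
rewrite ge0_integralZl//; last 3 first.
- exact/measurable_EFinP.
- by move=> y _; rewrite lee_fin !mulr_ge0 ?powR_ge0.
- by rewrite lee_fin ltW.
under [X in _ + (X + _)]eq_integral do rewrite EFinM.
rewrite ge0_integralZl//; last 3 first.
- exact/measurable_EFinP.
- by move=> y _; rewrite lee_fin.
- by rewrite lee_fin mulr_ge0// ltW.
rewrite ge0_integralZl//; last by rewrite lee_fin divr_ge0 ?mulr_ge0 ?powR_ge0 ?ltW.
have -> : \int[mu]_y (p0 y)%:E = 1 by case: p0_density.
rewrite mule1 /weighted_power WEq poweR_EFin -EFinM -/k.
(* The Young weights 1 - u, on p0 of mass 1, and u, on J of mass at most W eta, recombine to exactly
   k eta^u. *)
apply: (@le_trans _ _ (k%:E * a%:E + ((k * eta `^ u * (1 - u))%:E +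
   (k * eta `^ u * u / (W * eta))%:E * (W * eta)%:E))).
  apply: leeD; first by apply: lee_wpmul2l; rewrite ?lee_fin ?(ltW k0)//; exact: aff.
  apply: leeD => //; apply: lee_wpmul2l => //.
  by rewrite lee_fin divr_ge0 ?mulr_ge0 ?powR_ge0 ?ltW.
rewrite -!EFinM -!EFinD lee_fin divfK ?mulf_neq0 ?gt_eqF//.
by lra.
Qed.

End steps.

(** * Expected posterior mass *)

Section posterior.
Context dH (H : measurableType dH) (R : realType) (pi : probability H R).

Lemma inverse_power_lower_bound (t kappa l eta : R) (K : set H) (L : H -> R) :
  measurable K -> (0 < t)%R -> (0 < l)%R -> (0 < eta)%R -> (0 < kappa)%R ->
  pi K = kappa%:E -> measurable_fun setT L -> (forall h, 0 <= L h)%R ->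
  \int[pi]_(h in K) (L h)%:E <= eta%:E ->
  (l * (l * kappa / (2 * eta)) `^ t * (kappa / 2))%:E
  <= inverse_power pi t K l L.
Proof.
move=> mK t0 l0 eta0 k0 piK mL L0 intL.
(* The Markov threshold: eta / a = kappa / 2, so the part of K where L >= a takes at most half of
   its mass. *)
pose a := (2 * eta / kappa)%R.
have a0 : (0 < a)%R by rewrite divr_gt0// mulr_gt0.
have mLK : measurable_fun K (fun h => (L h)%:E).
  by apply: measurable_funTS; exact/measurable_EFinP.
pose B := K `&` [set h | a%:E <= `|(L h)%:E|].
have mB : measurable B.
  have -> : B = K `&` (fun h => (L h)%:E) @^-1` `[a%:E, +oo[%classic.
    congr (_ `&` _); apply/seteqP.
    by split=> h; rewrite /= in_itv/= andbT !lee_fin ger0_norm.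
  by apply: mLK => //; exact: emeasurable_itv.
have [b bE] : exists b, pi B = b%:E.
  by exists (fine (pi B)); rewrite fineK// fin_num_measure.
have piB : pi B <= (kappa / 2)%:E.
  have aB : a%:E * pi B <= eta%:E.
    apply: le_trans (le_integral_abse pi mK mLK a0) _.
    by under eq_integral do rewrite abse_EFin ger0_norm//.
  move: aB; rewrite bE -EFinM !lee_fin => aB.
  rewrite -(ler_pM2l a0) (le_trans aB)// /a.
  by rewrite (_ : 2 * eta / kappa * (kappa / 2) = eta)%R//; field; rewrite gt_eqF.
pose E := K `\` B.
have mE : measurable E by exact: measurableD.
have piE : (kappa / 2)%:E <= pi E.
  have -> : pi E = pi K - pi (K `&` B).
    by apply: measureD => //; rewrite ltey_eq fin_num_measure.
  have -> : K `&` B = B by rewrite /B setIA setIid.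
  move: piB; rewrite piK bE -EFinB !lee_fin.
  by lra.
have mQ : measurable_fun K (fun h => l%:E * ratio_pow t l (L h)).
  by apply: measurable_funTS; exact: (@measurable_ratio_pow _ H R t (fun=> l) L).
have Q0 h : 0 <= l%:E * ratio_pow t l (L h).
  by rewrite mule_ge0 ?ratio_pow_ge0// lee_fin ltW.
apply: (@le_trans _ _ (\int[pi]_(h in E) (l * (l * kappa / (2 * eta)) `^ t)%:E)).
  rewrite [leRHS](integral_cst pi mE) [leLHS]EFinM; apply: lee_wpmul2l => //.
  by rewrite lee_fin mulr_ge0 ?powR_ge0// ltW.
apply: (@le_trans _ _ (\int[pi]_(h in E) (l%:E * ratio_pow t l (L h)))); last first.
  by apply: ge0_subset_integral => //; exact: subDsetl.
rewrite [leLHS]integral_mkcond [leRHS]integral_mkcond.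
apply: le_nonneg_integral => h; rewrite !patchE; case: ifPn => //.
  by move=> _; rewrite lee_fin mulr_ge0 ?powR_ge0// ltW.
rewrite inE => -[Kh nB]; rewrite EFinM; apply: lee_wpmul2l; first by rewrite lee_fin ltW.
rewrite /ratio_pow t0; case: ifPn => [_|Ln0]; first exact: leey.
have Lp : (0 < L h)%R by rewrite lt0r Ln0 L0.
have La : (L h < a)%R.
  rewrite ltNge; apply/negP => aL; apply: nB; split => //=.
  by rewrite lee_fin ger0_norm.
rewrite lee_fin; apply: ge0_ler_powR; rewrite ?nnegrE ?(ltW t0)//.
- by rewrite divr_ge0// ?mulr_ge0// ltW.
- by rewrite divr_ge0// ltW.
have -> : (l * kappa / (2 * eta) = l / a)%R by rewrite /a invf_div mulrA.
by rewrite ler_wpM2l ?(ltW l0)// lef_pV2 ?posrE// ltW.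
Qed.

(** Since x/r <= 1, it is at most (x/r)^u. Writing l = l^(1-u) l^u then isolates (l/r)^u, which is
    at most M^u. *)
Lemma posterior_fraction (x r l M u : R) :
  (0 < u)%R -> (u < 1)%R -> (0 <= x)%R -> (x <= r)%R -> (0 < r)%R ->
  (0 < l)%R -> (l <= M * r)%R ->
  (x / r * l <= M `^ u * (l `^ (1 - u) * x `^ u))%R.
Proof.
move=> u0 u1 x0 xr r0 l0 lM.
have xr0 : (0 <= x / r)%R by rewrite divr_ge0// ltW.
have h1 : (x / r <= (x / r) `^ u)%R.
  have [->|xn0] := eqVneq x 0%R; first by rewrite mul0r powR_ge0.
  have xp : (0 < x)%R by rewrite lt0r xn0.
  by apply: ger1_powR; rewrite ?(ltW u1)// divr_gt0//= ler_pdivrMr// mul1r.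
have lE : (l = l `^ (1 - u) * l `^ u)%R.
  rewrite -powRD ?subrK ?powRr1 ?(ltW l0)//.
  by rewrite oner_eq0.
have h2 : ((l / r) `^ u <= M `^ u)%R.
  have lr : (l / r <= M)%R by rewrite ler_pdivrMr.
  have lr0 : (0 <= l / r)%R by rewrite divr_ge0// ltW.
  by apply: ge0_ler_powR; rewrite ?nnegrE ?(ltW u0)// (le_trans lr0 lr).
apply: (@le_trans _ _ ((x / r) `^ u * l)%R); first by rewrite ler_wpM2r// ltW.
have -> : ((x / r) `^ u * l = (l / r) `^ u * (l `^ (1 - u) * x `^ u))%R.
  have ri : (0 <= r^-1)%R by rewrite invr_ge0 ltW.
  rewrite [in LHS]lE !powRM ?(ltW l0)//; ring.
by rewrite ler_wpM2r// mulr_ge0 ?powR_ge0.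
Qed.

Lemma posterior_pointwise (u t kappa l M : R) (PP K : set H)
    (C : nat -> set H) (L : H -> R) :
  (0 < u)%R -> (u < 1)%R -> (0 < t)%R -> (0 <= l)%R -> (0 < M)%R ->
  (0 < kappa)%R -> pi K = kappa%:E ->
  measurable PP -> measurable K -> K `<=` PP ->
  (forall j, measurable (C j)) -> (forall j, C j `<=` PP) -> trivIset setT C ->
  measurable_fun setT L -> (forall h, 0 <= L h)%R ->
  (\int[pi]_(h in \bigcup_j C j) (L h)%:E / \int[pi]_(h in PP) (L h)%:E) * l%:E
  <= \sum_(j <oo) ((M `^ u)%:E * weighted_power pi u (C j) l L) +
     ((M * kappa / 2) `^ t * (kappa / 2))^-1%:E * inverse_power pi t K l L.
Proof.
move=> u0 u1 t0 l0 M0 k0 piK mPP mK KPP mC CPP tC mL L0.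
have sum0 : 0 <= \sum_(j <oo) ((M `^ u)%:E * weighted_power pi u (C j) l L).
  by apply: nneseries_ge0 => j _ _; rewrite mule_ge0 ?weighted_power_ge0// lee_fin powR_ge0.
have b0 : (0 < (M * kappa / 2) `^ t * (kappa / 2))%R.
  by rewrite mulr_gt0 ?powR_gt0 ?divr_gt0 ?mulr_gt0.
have inv0 : 0 <= ((M * kappa / 2) `^ t * (kappa / 2))^-1%:E * inverse_power pi t K l L.
  by rewrite mule_ge0 ?inverse_power_ge0// lee_fin invr_ge0 ltW.
have rhs0 := adde_ge0 sum0 inv0.
have mLE A : measurable_fun A (fun h => (L h)%:E).
  by apply: measurable_funTS; exact/measurable_EFinP.
have int0 A : 0 <= \int[pi]_(h in A) (L h)%:E.
  by apply: integral_ge0 => h _; rewrite lee_fin.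
have le_PP A : measurable A -> A `<=` PP ->
    \int[pi]_(h in A) (L h)%:E <= \int[pi]_(h in PP) (L h)%:E.
  by move=> mA AP; apply: ge0_subset_integral => // h _; rewrite lee_fin.
have mU : measurable (\bigcup_j C j) by exact: bigcup_measurable.
have UPP : \bigcup_j C j `<=` PP by move=> h [j _ /CPP].
have NU0 : 0 <= \int[pi]_(h in \bigcup_j C j) (L h)%:E by [].
have NUle := le_PP _ mU UPP.
have D0 : 0 <= \int[pi]_(h in PP) (L h)%:E by [].
(* An infinite denominator has inverse 0, so the left side is 0. A zero denominator, treated next,
   forces the numerator to be 0. *)
case DE : (\int[pi]_(h in PP) (L h)%:E) D0 => [r| |//]; last first.
  by rewrite invey mule0 mul0e.
rewrite lee_fin le_eqVlt => /predU1P[r0|r0].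
  rewrite (_ : \int[pi]_(h in \bigcup_j C j) _ = 0) ?mul0e//.
  by apply/eqP; rewrite eq_le NU0 andbT (le_trans NUle)// DE -r0.
have [l00|ln0] := eqVneq l 0%R; first by rewrite [X in _ * X%:E]l00 mule0.
have {}l0 : (0 < l)%R by rewrite lt0r ln0.
rewrite inver gt_eqF//.
have rl0 : (0 <= r^-1 * l)%R by rewrite mulr_ge0 ?invr_ge0 ?(ltW r0) ?(ltW l0).
have [lM|Ml] := leP l (M * r)%R.
  apply: le_trans (leeDl _ inv0).
  rewrite ge0_integral_bigcup//; last by move=> h _; rewrite lee_fin.
  rewrite -muleA muleC -EFinM -nneseriesZl//.
  apply: lee_nneseries => [j _ _|j _].
    by rewrite mule_ge0// lee_fin.
  have xr := le_PP _ (mC j) (CPP j).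
  have x0 : 0 <= \int[pi]_(h in C j) (L h)%:E by [].
  rewrite /weighted_power; move: x0 xr; rewrite DE.
  case: (\int[pi]_(h in C j) (L h)%:E) => [x| |//]; last by rewrite leye_eq.
  move=> x0 xr; rewrite poweR_EFin -!EFinM lee_fin.
  rewrite !lee_fin in x0 xr.
  have -> : (r^-1 * l * x = x / r * l)%R by rewrite mulrC mulrA.
  exact: posterior_fraction.
apply: le_trans (leeDr _ sum0).
(* Here M r < l, so the likelihood integrates to at most l/M over K. With eta = l/M the lower bound
   makes the last term at least l, while the posterior mass is at most 1. *)
have eta0 : (0 < l / M)%R by rewrite divr_gt0.
have rle : \int[pi]_(h in K) (L h)%:E <= (l / M)%:E.
  by rewrite (le_trans (le_PP _ mK KPP))// DE lee_fin ler_pdivlMr// mulrC ltW.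
have := inverse_power_lower_bound mK t0 l0 eta0 k0 piK mL L0 rle.
have -> : (l * kappa / (2 * (l / M)) = M * kappa / 2)%R.
  by field; rewrite !gt_eqF.
move=> low; apply: (@le_trans _ _ l%:E).
  rewrite -[leRHS]mul1e; apply: lee_wpmul2r; first by rewrite lee_fin ltW.
  rewrite (le_trans (lee_wpmul2r _ NUle)) ?lee_fin ?invr_ge0 ?(ltW r0)// DE.
  by rewrite -EFinM lee_fin divff ?gt_eqF.
apply: le_trans (lee_wpmul2l _ low); last by rewrite lee_fin invr_ge0 ltW.
rewrite -EFinM lee_fin -[(l * _ * _)%R]mulrA mulrCA mulVf ?mulr1//.
by rewrite gt_eqF.
Qed.

End posterior.

Section posterior_expectation.
Context d (T : measurableType d) (R : realType).
Variables (mu : {measure set T -> \bar R}) (p0 : T -> R).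
Hypothesis p0_density : is_density mu p0.
Context dH (H : measurableType dH) (pi : probability H R).
Variable e : H -> T -> R.
Hypotheses (me : measurable_fun setT (fun z : H * T => e z.1 z.2))
  (e0 : forall h y, (0 <= e h y)%R).

(** One observation y multiplies both likelihoods in the state; [ok] below is the invariant that it
    preserves. *)
Let act (x : R * (H -> R)) (y : T) : R * (H -> R) :=
  (x.1 * p0 y, fun h => x.2 h * e h y)%R.

Let ok (x : R * (H -> R)) : Prop :=
  [/\ (0 <= x.1)%R, measurable_fun setT x.2 & forall h, (0 <= x.2 h)%R].

Let p0_ge0 y : (0 <= p0 y)%R. Proof. by case: p0_density. Qed.

Let me_y y : measurable_fun setT (e ^~ y).
Proof. exact: (measurableT_comp me (measurable_pair2 y)). Qed.

Let ok_act x y : ok x -> ok (act x y).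
Proof.
by case=> c0 mw w0; split => [|/=|h /=]; [exact: mulr_ge0|exact: measurable_funM|exact: mulr_ge0].
Qed.

Let foldl_act n (Y : n.-tuple T) c w :
  foldl act (c, w) Y = (c * likelihood p0 Y, fun h => w h * likelihood (e h) Y)%R.
Proof.
elim: n Y c w => [|n IH] Y c w.
  rewrite tuple0 /= likelihood0 mulr1; congr (_, _).
  by apply/funext => h; rewrite likelihood0 mulr1.
case/tupleP: Y => y Y /=; rewrite {1}/act/= IH likelihood_cons mulrA.
by congr (_, _); apply/funext => h; rewrite likelihood_cons mulrA.
Qed.

Lemma posterior_expectation (u t kappa M a eta tau : R) (PP K : set H)
    (C : nat -> set H) n :
  (0 < u)%R -> (u < 1)%R -> (0 < t)%R -> (0 < M)%R -> (0 < kappa)%R ->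
  pi K = kappa%:E -> measurable PP -> measurable K -> K `<=` PP ->
  (forall j, measurable (C j)) -> (forall j, C j `<=` PP) -> trivIset setT C ->
  (0 <= a)%R -> (0 < eta)%R -> (0 <= tau)%R ->
  (forall j h, C j h -> \int[mu]_y (p0 y `^ (1 - u) * e h y `^ u)%:E <= a%:E) ->
  (forall j h h', C j h -> C j h' ->
    \int[mu]_y `|e h y - e h' y|%:E <= eta%:E) ->
  (forall h, K h ->
    \int[mu]_y ((p0 y)%:E * ratio_pow t (p0 y) (e h y)) <= tau%:E) ->
  sample_integral mu (fun Y : n.-tuple T =>
    (\int[pi]_(h in \bigcup_j C j) (likelihood (e h) Y)%:E /
     \int[pi]_(h in PP) (likelihood (e h) Y)%:E) * (likelihood p0 Y)%:E)
  <= (M `^ u * (a + eta `^ u) ^+ n)%:E * \sum_(j <oo) pi (C j) `^ u +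
     (((M * kappa / 2) `^ t * (kappa / 2))^-1 * tau ^+ n * kappa)%:E.
Proof.
move=> u0 u1 t0 M0 k0 piK mPP mK KPP mC CPP tC a0 eta0 tau0 haff hdiam hK.
set B := ((M * kappa / 2) `^ t * (kappa / 2))^-1%R.
have B0 : (0 <= B)%R.
  by rewrite invr_ge0 mulr_ge0 ?powR_ge0 ?divr_ge0// ltW.
have au0 : (0 <= a + eta `^ u)%R by rewrite addr_ge0// powR_ge0.
have cof0 k : (0 <= M `^ u * (a + eta `^ u) ^+ k)%R.
  by rewrite mulr_ge0 ?powR_ge0 ?exprn_ge0.
have Bt0 k : (0 <= B * tau ^+ k)%R by rewrite mulr_ge0 ?exprn_ge0.
(* The index k counts the observations still to be integrated out. [Phi 0] at the final state is the
   bound of [posterior_pointwise]; [Phi n] at the initial state (1, 1) reduces to the right side of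
   the claim. *)
pose Phi k (x : R * (H -> R)) : \bar R :=
  \sum_(j <oo) ((M `^ u * (a + eta `^ u) ^+ k)%:E * weighted_power pi u (C j) x.1 x.2)
  + (B * tau ^+ k)%:E * inverse_power pi t K x.1 x.2.
have sum0 k x j : 0 <= (M `^ u * (a + eta `^ u) ^+ k)%:E * weighted_power pi u (C j) x.1 x.2.
  by rewrite mule_ge0 ?weighted_power_ge0// lee_fin.
have inv0 k x : ok x -> 0 <= (B * tau ^+ k)%:E * inverse_power pi t K x.1 x.2.
  by case=> c0 _ _; rewrite mule_ge0 ?inverse_power_ge0// lee_fin.
have Phi0 k x : ok x -> 0 <= Phi k x.
  by move=> okx; apply: adde_ge0; [apply: nneseries_ge0 => j _ _|exact: inv0].
have step k x : ok x -> \int[mu]_y Phi k (act x y) <= Phi k.+1 x.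
  move=> okx; have [c0 mw w0] := okx.
  have mWP j : measurable_fun setT (fun y => weighted_power pi u (C j) (act x y).1 (act x y).2).
    exact: (measurable_weighted_power p0_density pi me e0 u x.1 (mC j) mw w0).
  have mIP : measurable_fun setT (fun y => inverse_power pi t K (act x y).1 (act x y).2).
    exact: (measurable_inverse_power p0_density pi me e0 t mK c0 mw w0).
  have ip0 y : 0 <= inverse_power pi t K (act x y).1 (act x y).2.
    by apply: inverse_power_ge0; rewrite mulr_ge0.
  rewrite /Phi ge0_integralD//; last first.
  - exact: emeasurable_funM.
  - by move=> y _; apply: inv0; exact: ok_act.
  - by apply: ge0_emeasurable_sum => // j _; exact: emeasurable_funM.
  - by move=> y _; apply: nneseries_ge0 => j _ _.
  apply: leeD.
    rewrite integral_nneseries//; last by move=> j; exact: emeasurable_funM.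
    apply: lee_nneseries => [j _ _|j _]; first exact: integral_ge0.
    rewrite ge0_integralZl//; last 2 first.
    - by move=> y _; exact: weighted_power_ge0.
    - by rewrite lee_fin.
    rewrite exprSr mulrA [(_ * (a + _))%:E]EFinM -muleA; apply: lee_wpmul2l.
      by rewrite lee_fin.
    exact: (weighted_power_step p0_density pi me e0 (mC j) u0 u1 a0 eta0 c0 mw w0
      (haff j) (hdiam j)).
  rewrite ge0_integralZl//; last by rewrite lee_fin.
  rewrite exprSr mulrA [(_ * tau)%:E]EFinM -muleA; apply: lee_wpmul2l.
    by rewrite lee_fin.
  exact: (inverse_power_step p0_density pi me e0 mK t0 tau0 c0 mw w0 hK).
have ok1 : ok (1%R, fun=> 1%R).
  by split=> [|/=|h]; [exact: ler01|exact: measurable_cst|exact: ler01].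
have mlik (Y : n.-tuple T) : measurable_fun setT (fun h => likelihood (e h) Y).
  have : ok (foldl act (1%R, fun=> 1%R) Y).
    elim: (Y : seq T) (1%R, fun=> 1%R) ok1 => //= y s IH x okx.
    by apply: IH; exact: ok_act.
  rewrite foldl_act => -[_ /= + _].
  by under eq_fun do rewrite mul1r.
apply: (@le_trans _ _ (Phi n (1%R, fun=> 1%R))); last first.
  rewrite /Phi /= nneseriesZl; last by move=> j _; exact: weighted_power_ge0.
  apply: leeD.
    apply: lee_wpmul2l; first by rewrite lee_fin.
    apply: lee_nneseries => [j _ _|j _]; first exact: weighted_power_ge0.
    by rewrite /weighted_power powR1 mul1e (integral_cst pi (mC j)) mul1e.
  rewrite [(_ * kappa)%:E]EFinM; apply: lee_wpmul2l; first by rewrite lee_fin.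
  rewrite /inverse_power /ratio_pow oner_eq0 divr1 powR1 mul1e.
  by rewrite (integral_cst pi mK) mul1e -piK.
apply: le_trans (sample_integral_supermartingale ok_act Phi0 step n ok1).
apply: le_sample_integral => Y.
  rewrite !mule_ge0//.
  - by apply: integral_ge0 => h _; rewrite lee_fin likelihood_ge0.
  - by rewrite inve_ge0; apply: integral_ge0 => h _; rewrite lee_fin likelihood_ge0.
  - by rewrite lee_fin likelihood_ge0.
rewrite foldl_act /Phi /= mul1r !expr0 !mulr1.
under [fun h => (1 * _)%R]eq_fun do rewrite mul1r.
apply: posterior_pointwise => //.
- exact: likelihood_ge0.
- by move=> h; exact: likelihood_ge0.
Qed.

End posterior_expectation.

(** * Divergences *)

Section divergence.
Context d (T : measurableType d) (R : realType).
Variable mu : {measure set T -> \bar R}.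

(** The integral of f may be infinite, but the negative part of g = f - p is at most p and so has
    finite integral. Integrating the identity f + g^- = g^+ + p between nonnegative functions and
    rearranging is then legitimate. *)
Lemma integral_sub_density (p : T -> R) (f : T -> \bar R) :
  is_density mu p -> measurable_fun setT f -> (forall y, 0 <= f y) ->
  \int[mu]_y (f y - (p y)%:E) = \int[mu]_y f y - 1.
Proof.
move=> [mp p0 p1] mf f0.
pose g y := f y - (p y)%:E.
have mpE : measurable_fun setT (fun y => (p y)%:E) by exact/measurable_EFinP.
have mg : measurable_fun setT g by exact: emeasurable_funB.
have key y : f y + g^\- y = g^\+ y + (p y)%:E.
  rewrite funeposE funenegE /g; case: (f y) (f0 y) => [r _||//].
    rewrite /= -!EFin_max -!EFinD; congr (_%:E).
    case: (leP (r - p y) 0)%R => h1; case: (leP (- (r - p y)) 0)%R => h2; lra.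
  by move=> _; rewrite [+oo - _]addye// maxye /= maxNye adde0 addye.
have neg_le y : g^\- y <= (p y)%:E.
  rewrite funenegE /g ge_max; apply/andP; split; last by rewrite lee_fin.
  rewrite leeNl; case: (f y) (f0 y) => [r|_|//]; last by rewrite leey.
  by rewrite lee_fin -EFinB lee_fin => r0; rewrite lerBrDl addrN.
have int_neg : \int[mu]_y g^\- y <= 1.
  by rewrite -p1; apply: le_nonneg_integral.
have neg_fin : \int[mu]_y g^\- y \is a fin_num.
  by rewrite ge0_fin_numE ?integral_ge0//; exact: le_lt_trans int_neg (ltry _).
have : \int[mu]_y f y + \int[mu]_y g^\- y = \int[mu]_y g^\+ y + 1.
  rewrite -p1 -!ge0_integralD//; first by apply: eq_integral => y _; exact: key.
  - exact: measurable_funepos.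
  - by move=> y _; rewrite lee_fin.
  - exact: measurable_funeneg.
have -> : \int[mu]_y (f y - (p y)%:E) = \int[mu]_y g^\+ y - \int[mu]_y g^\- y.
  by rewrite integralE.
case: (\int[mu]_y g^\- y) neg_fin => // b _.
have f0' : 0 <= \int[mu]_y f y by exact: integral_ge0.
have gp0 : 0 <= \int[mu]_y g^\+ y by exact: integral_ge0.
case: (\int[mu]_y f y) f0' => [x _| _|//];
  case: (\int[mu]_y g^\+ y) gp0 => [z _| _|//] //=.
rewrite -!EFinD => -[h]; congr (_%:E); lra.
Qed.

Lemma divergenceE (t : R) (p q : T -> R) : is_density mu p -> is_density mu q ->
  divergence mu t p q =
  (t^-1)%:E * (\int[mu]_y ((p y)%:E * ratio_pow t (p y) (q y)) - 1).
Proof.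
move=> dp dq; have [mp p0 _] := dp; have [mq q0 _] := dq.
rewrite /divergence -(integral_sub_density dp).
- congr (_ * _); apply: eq_integral => y _.
  rewrite muleBr ?mule1//; first exact: fin_num_adde_defl.
- exact: measurable_ratio_pow.
- by move=> y; rewrite mule_ge0 ?ratio_pow_ge0// lee_fin.
Qed.

(** For negative exponents the kernel is that of a Hellinger-type affinity; the value 0 of
    [ratio_pow] at b = 0 agrees with b^u = 0. *)
Lemma ratio_pow_opp (u a b : R) : (0 < u)%R -> (u < 1)%R -> (0 <= a)%R -> (0 <= b)%R ->
  a%:E * ratio_pow (- u) a b = (a `^ (1 - u) * b `^ u)%:E.
Proof.
move=> u0 u1 a0 b0; rewrite /ratio_pow oppr_gt0 (ltNge u) (ltW u0) /=.
have un0 : u != 0%R by rewrite gt_eqF.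
have u1n0 : (1 - u != 0)%R by rewrite subr_eq0 gt_eqF.
have [->|bn0] := eqVneq b 0%R; first by rewrite mule0 powR0// mulr0.
have [->|an0] := eqVneq a 0%R; first by rewrite mul0e powR0// mul0r.
have ap : (0 < a)%R by rewrite lt0r an0.
have bp : (0 < b)%R by rewrite lt0r bn0.
rewrite -EFinM /powR (negbTE an0) (negbTE bn0) gt_eqF ?divr_gt0//.
rewrite ln_div ?posrE// -{1}[a]lnK ?posrE// -!expRD.
by congr (expR _)%:E; ring.
Qed.

Lemma divergence_opp (u : R) (p q : T -> R) : (0 < u)%R -> (u < 1)%R ->
  is_density mu p -> is_density mu q ->
  divergence mu (- u) p q =
  ((- u)^-1)%:E * (\int[mu]_y (p y `^ (1 - u) * q y `^ u)%:E - 1).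
Proof.
move=> u0 u1 dp dq; rewrite divergenceE//.
have [_ p0 _] := dp; have [_ q0 _] := dq.
by under eq_integral do rewrite ratio_pow_opp//.
Qed.

(** The integral is 1 + t d_t^2(p, q), at most 1 + t s <= exp(t s). The exponential form is
    convenient for n-th powers. *)
Lemma divergence_pos_le (t s : R) (p q : T -> R) : (0 < t)%R ->
  is_density mu p -> is_density mu q -> divergence mu t p q <= s%:E ->
  \int[mu]_y ((p y)%:E * ratio_pow t (p y) (q y)) <= (expR (t * s))%:E.
Proof.
move=> t0 dp dq; rewrite divergenceE//.
have [_ p0 _] := dp.
have : 0 <= \int[mu]_y ((p y)%:E * ratio_pow t (p y) (q y)).
  by apply: integral_ge0 => y _; rewrite mule_ge0 ?ratio_pow_ge0// lee_fin.
case: (\int[mu]_y _) => [x _| _|//]; last first.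
  by rewrite addye// gt0_muley ?lte_fin ?invr_gt0// leye_eq.
rewrite -EFinB -EFinM !lee_fin ler_pdivrMl// => h.
by apply: le_trans (expR_ge1Dx _); lra.
Qed.

Lemma divergence_opp_gt (u eps : R) (p q : T -> R) : (0 < u)%R -> (u < 1)%R ->
  is_density mu p -> is_density mu q -> eps%:E < divergence mu (- u) p q ->
  \int[mu]_y (p y `^ (1 - u) * q y `^ u)%:E <= (1 - u * eps)%:E.
Proof.
move=> u0 u1 dp dq; rewrite divergence_opp//.
have : 0 <= \int[mu]_y (p y `^ (1 - u) * q y `^ u)%:E.
  by apply: integral_ge0 => y _; rewrite lee_fin mulr_ge0 ?powR_ge0.
case: (\int[mu]_y _) => [x _| _|//]; last first.
  by rewrite addye// lt0_muley ?lte_fin ?invr_lt0 ?oppr_lt0.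
rewrite -EFinB -EFinM lte_fin lee_fin invrN mulNr -mulrN opprB.
rewrite [(_^-1 * _)%R]mulrC ltr_pdivlMr// => h; lra.
Qed.

(** The integral in [divergenceE] is nonnegative. The bound keeps suprema and infima of divergences
    away from -oo. *)
Lemma divergence_ge (t : R) (p q : T -> R) : (0 < t)%R ->
  is_density mu p -> is_density mu q -> (- t^-1)%:E <= divergence mu t p q.
Proof.
move=> t0 dp dq; have [_ p0 _] := dp; rewrite divergenceE// EFinN -muleN1.
apply: lee_wpmul2l; first by rewrite lee_fin invr_ge0 ltW.
rewrite -[leLHS]add0e; apply: leeD2r.
by apply: integral_ge0 => y _; rewrite mule_ge0 ?ratio_pow_ge0// lee_fin.
Qed.

End divergence.

Lemma L1_ball_diameter d (T : measurableType d) (R : realType)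
    (mu : {measure set T -> \bar R}) (c f g : T -> R) (r : R) :
  is_density mu c -> L1_ball mu c r f -> L1_ball mu c r g ->
  \int[mu]_y `|f y - g y|%:E <= (2 * r)%:E.
Proof.
move=> [mc _ _] [[mf _ _] cf] [[mg _ _] cg].
rewrite mulr_natl mulr2n EFinD.
apply: le_trans (leeD (ltW cf) (ltW cg)).
rewrite -ge0_integralD//.
- apply: le_nonneg_integral => y //; rewrite -EFinD lee_fin.
  have -> : (f y - g y = (c y - g y) - (c y - f y))%R by ring.
  by rewrite [leRHS]addrC ler_normB.
- by apply/measurable_EFinP; apply: measurableT_comp => //; exact: measurable_funB.
- by apply/measurable_EFinP; apply: measurableT_comp => //; exact: measurable_funB.
Qed.

(** * Numerical estimates *)

Lemma sum_inv_sqr_le (R : realType) n :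
  (\sum_(0 <= k < n) (k%:R ^- 2) <= 2 :> R)%R.
Proof.
(* The bound is strengthened by 1/(m+1) so that the induction closes; the term k = 0 is 0 because
   the inverse of 0 is 0. *)
have h m : (\sum_(0 <= k < m.+2) (k%:R ^- 2) <= 2 - m.+1%:R^-1 :> R)%R.
  elim: m => [|m IH].
    by rewrite big_nat_recr//= big_nat1 expr0n/= invr0 expr1n !invr1; lra.
  rewrite big_nat_recr//=; apply: le_trans (lerD IH (lexx _)) _.
  have a0 : (0 < m.+1%:R :> R)%R by [].
  have -> : (m.+2%:R = m.+1%:R + 1 :> R)%R by rewrite -natr1.
  rewrite -addrA lerD2l -subr_ge0.
  have -> : (- (m.+1%:R + 1)^-1 - (- m.+1%:R^-1 + (m.+1%:R + 1) ^- 2) =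
    (m.+1%:R * (m.+1%:R + 1) ^+ 2)^-1 :> R)%R.
    by field; rewrite !gt_eqF// addr_gt0.
  by rewrite invr_ge0 mulr_ge0// exprn_ge0// addr_ge0.
case: n => [|[|m]]; first by rewrite big_geq.
  by rewrite big_nat1 expr0n/= invr0.
by apply: le_trans (h m) _; rewrite gerBl invr_ge0.
Qed.

(** M is chosen so that (M kappa / 2)^t = n^2 exp(n t s), which turns the second summand into
    exactly 2/n^2. In the first, the term (2/u) ln n of n eps supplies n^(-2), while (2/t) ln n
    cancels the power of n in M^u. What remains is 2 u ln 2 from the factors 2 in M and 2 N, u from
    the slack 1/n in s, and 2 from the n-th power of exp(2/n). *)
Lemma inverse_square_bound (R : realType) (n : nat) (u t kappa N s v0 eps M : R) :
  (0 < n)%N -> (0 < u)%R -> (0 < t)%R -> (0 < kappa)%R -> (0 < N)%R ->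
  (s - n%:R^-1 * ln kappa <= v0 + n%:R^-1)%R ->
  eps = (v0 + n%:R^-1 * (ln N + 2 * (u^-1 + t^-1) * ln n%:R))%R ->
  M = (2 * expR (2 / t * ln n%:R + n%:R * s) / kappa)%R ->
  (M `^ u * expR (- (u * eps) + 2 / n%:R) ^+ n * (2 * N) `^ u +
   ((M * kappa / 2) `^ t * (kappa / 2))^-1 * expR (t * s) ^+ n * kappa
   <= (expR (2 * u * ln 2 + u + 2) + 2) * n%:R ^- 2)%R.
Proof.
move=> n0 u0 t0 k0 N0 hs epsE ME.
have nR : (0 < n%:R :> R)%R by rewrite ltr0n.
have nn0 : (n%:R != 0 :> R)%R by rewrite gt_eqF.
have tn0 : (t != 0)%R by rewrite gt_eqF.
have un0 : (u != 0)%R by rewrite gt_eqF.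
have powE (x a : R) : (0 < x)%R -> (x `^ a = expR (a * ln x))%R.
  by move=> x0; rewrite /powR gt_eqF.
have sqE : (n%:R ^- 2 = expR (- (2 * ln n%:R)) :> R)%R.
  by rewrite expRN expRM_natl lnK// posrE.
have M0 : (0 < M)%R by rewrite ME divr_gt0// mulr_gt0// expR_gt0.
have lnM' : (ln M = ln 2 + (2 / t * ln n%:R + n%:R * s) - ln kappa)%R.
  by rewrite ME ln_div ?posrE ?mulr_gt0 ?expR_gt0// lnM ?posrE ?expR_gt0// expRK.
rewrite [leRHS]mulrDl; apply: lerD.
  rewrite !powE ?mulr_gt0// -expRM_natl lnM' lnM ?posrE// sqE -!expRD ler_expR.
  have hs' : (n%:R * s - ln kappa <= n%:R * v0 + 1)%R.
    have := ler_wpM2l (ltW nR) hs.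
    by rewrite mulrBr mulrDr !mulrA divff// !mul1r.
  have := ler_wpM2l (ltW u0) hs'.
  have -> : (n%:R * (- (u * eps) + 2 / n%:R) =
     - (u * (n%:R * v0)) - u * ln N - 2 * ln n%:R - 2 * u / t * ln n%:R + 2)%R.
    by rewrite epsE; field; rewrite nn0 un0 tn0.
  by move=> h; rewrite -subr_ge0; rewrite -subr_ge0 in h; apply: le_trans h _; lra.
have -> : (M * kappa / 2 = expR (2 / t * ln n%:R + n%:R * s))%R.
  by rewrite ME divfK ?gt_eqF// mulrC mulKf.
rewrite powE ?expR_gt0// expRK sqE -expRM_natl.
have -> : (t * (2 / t * ln n%:R + n%:R * s) = 2 * ln n%:R + n%:R * (t * s))%R.
  by field.
rewrite expRD expRN.
rewrite le_eqVlt; apply/orP; left; apply/eqP.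
by field; rewrite !gt_eqF ?expR_gt0.
Qed.

Lemma sample_integral0 d (T : measurableType d) (R : realType)
    (mu : {measure set T -> \bar R}) n :
  sample_integral mu (fun _ : n.-tuple T => 0) = 0.
Proof. by elim: n => //= n IH; apply: integral0_eq => y _. Qed.

(** * Prior complexity and the set of bad densities *)

Section prior.
Context d (T : measurableType d) (R : realType).
Variables (mu : {measure set T -> \bar R}) (G : set (set (T -> R)))
  (pi : probability (g_sigma_algebraType G) R) (PP : set (T -> R)).
Hypothesis pi_prior : prior_on mu pi PP.

Let mPP : measurable (PP : set (g_sigma_algebraType G)).
Proof. by case: pi_prior. Qed.

Lemma probability_le_power (u : R) (A : set (g_sigma_algebraType G)) :
  (0 < u)%R -> (u <= 1)%R -> measurable A -> pi A <= pi A `^ u.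
Proof.
move=> u0 u1 mA; have : 0 <= pi A by [].
have : pi A <= 1 by exact: probability_le1.
case: (pi A) => [x||//]; last by rewrite leye_eq.
rewrite poweR_EFin !lee_fin => x1 x0.
have [->|xn0] := eqVneq x 0%R; first exact: powR_ge0.
by apply: ger1_powR => //; rewrite x1 lt0r xn0 x0.
Qed.

(** Padding with empty sets indexes the cover by all of nat; they add nothing to the sum, as 0^u = 0
    for u > 0. *)
Lemma cover_sequence (u r : R) (J : set nat) (c : nat -> T -> R) :
  (0 < u)%R ->
  (forall j, J j -> is_density mu (c j)) ->
  (forall j, J j -> G.-sigma.-measurable (PP `&` L1_ball mu (c j) r)) ->
  PP `<=` \bigcup_(j in J) L1_ball mu (c j) r ->
  exists B : nat -> set (g_sigma_algebraType G),
    [/\ forall j, measurable (B j), forall j, B j `<=` PP,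
        PP `<=` \bigcup_j B j,
        forall j f g, B j f -> B j g ->
          \int[mu]_y `|f y - g y|%:E <= (2 * r)%:E &
        \esum_(j in J) pi (PP `&` L1_ball mu (c j) r) `^ u =
        \sum_(j <oo) pi (B j) `^ u].
Proof.
move=> u0 dc mB cover.
exists (fun j => if j \in J then PP `&` L1_ball mu (c j) r else set0); split.
- by move=> j; case: ifPn => [|_]; [rewrite inE => /mB|exact: measurable0].
- by move=> j; case: ifPn => // _ f [].
- move=> f Pf; have [j Jj cf] := cover f Pf.
  by exists j => //; rewrite mem_set.
- move=> j f g; case: ifPn => //; rewrite inE => Jj [_ cf] [_ cg].
  by apply: L1_ball_diameter cf cg; exact: dc.
- rewrite esum_mkcond nneseries_esumT.
    apply: eq_esum => j _; case: ifPn => // _.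
    by rewrite measure0 poweR0r// gt_eqF.
  by move=> j; exact: poweR_ge0.
Qed.

(** For every cover, 1 = pi(PP) is at most the sum of the pi(B_j), and each pi(B_j) <= 1 is at most
    its u-th power. Hence the logarithm in the final bound is nonnegative. *)
Lemma norm_complexity_ge1 (u : R) n : (0 < u)%R -> (u <= 1)%R ->
  1 <= norm_complexity mu pi PP u n.
Proof.
move=> u0 u1; apply/ereal_infP => _ [J [c [dc mB cover ->]]].
have [B [mB' _ coverB _ ->]] := cover_sequence u0 dc mB cover.
have h1 : 1 <= \sum_(j <oo) pi (B j) `^ u.
  have piP : pi PP = 1 by case: pi_prior.
  rewrite -piP.
  apply: (@le_trans _ _ (\sum_(j <oo) pi (B j))).
    exact: measure_sigma_subadditive.
  apply: lee_nneseries => [j _ _|j _]; first exact: measure_ge0.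
  exact: probability_le_power.
have := @gt0_ler_poweR R u^-1 _ 1 _ _ _ h1.
rewrite poweR1r; apply; rewrite ?invr_ge0 ?(ltW u0)// in_itv/= ?lee01 ?leey//.
by rewrite (le_trans _ h1)// lee01.
Qed.

Lemma norm_complexity_cover (u N : R) n : (0 < u)%R -> (u <= 1)%R ->
  norm_complexity mu pi PP u n = N%:E ->
  exists B : nat -> set (g_sigma_algebraType G),
    [/\ forall j, measurable (B j), forall j, B j `<=` PP,
        PP `<=` \bigcup_j B j,
        forall j f g, B j f -> B j g ->
          \int[mu]_y `|f y - g y|%:E <= (2 * n%:R `^ (- u^-1))%:E &
        \sum_(j <oo) pi (B j) `^ u <= ((2 * N) `^ u)%:E].
Proof.
move=> u0 u1 NE.
have N1 : (1 <= N)%R by rewrite -lee_fin -NE norm_complexity_ge1.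
have N0 : (0 < N)%R by exact: lt_le_trans ltr01 N1.
have fin : norm_complexity mu pi PP u n \is a fin_num by rewrite NE.
(* The positive number N itself is the slack, so the chosen cover has norm below N + N = 2 N. *)
have [v [J [c [dc mB cover vE]]] vlt] := lb_ereal_inf_adherent N0 fin.
have [B [mB' BPP coverB diam sumE]] := cover_sequence u0 dc mB cover.
exists B; split => //.
have S0 : 0 <= \sum_(j <oo) pi (B j) `^ u.
  by apply: nneseries_ge0 => j _ _; exact: poweR_ge0.
have -> : \sum_(j <oo) pi (B j) `^ u = v `^ u.
  by rewrite vE sumE -poweRrM mulVf ?gt_eqF// poweRe1.
rewrite -poweR_EFin.
have v0 : 0 <= v by rewrite vE poweR_ge0.
apply: gt0_ler_poweR; rewrite ?(ltW u0)// ?in_itv/= ?leey ?andbT//.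
- by rewrite lee_fin mulr_ge0// ltW.
- by apply: le_trans (ltW vlt) _; rewrite -/(norm_complexity _ _ _ _ _) NE -EFinD lee_fin; lra.
Qed.

Lemma prior_divergence_near (t v : R) (p0 : T -> R) n :
  is_density mu p0 -> (0 < n)%N -> (0 < t)%R ->
  prior_divergence mu pi PP t p0 n = v%:E ->
  exists (K : set (g_sigma_algebraType G)) (s kappa : R),
    [/\ [/\ measurable K, K `<=` PP, (0 < kappa)%R & pi K = kappa%:E],
        forall q, K q -> divergence mu t p0 q <= s%:E &
        (s - n%:R^-1 * ln kappa <= v + n%:R^-1)%R].
Proof.
move=> dp0 n0 t0 vE.
have ninv : (0 < n%:R^-1 :> R)%R by rewrite invr_gt0 ltr0n.
have fin : prior_divergence mu pi PP t p0 n \is a fin_num by rewrite vE.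
have [x [K [mK KPP K0 xE]] xlt] := lb_ereal_inf_adherent ninv fin.
rewrite -/(prior_divergence _ _ _ _ _ _) vE -EFinD in xlt.
have piKfin : pi K \is a fin_num by rewrite fin_num_measure.
have kE : pi K = (fine (pi K))%:E by rewrite fineK.
have k0 : (0 < fine (pi K))%R by rewrite -lte_fin -kE.
have [Ke|/set0P[q Kq]] := eqVneq K set0.
  by move: K0; rewrite Ke measure0 ltxx.
have lnE : lne (pi K)^-1 = (- ln (fine (pi K)))%:E.
  by rewrite kE inver gt_eqF// lneV// lne_EFin.
have dq : is_density mu q by case: pi_prior => _ _ + _; apply; exact: KPP.
(* K has positive mass, hence a member q, and the supremum is not -oo; near-minimality of K excludes
   +oo. *)
have lower : (- t^-1)%:E <= ereal_sup [set divergence mu t p0 q | q in K].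
  apply: le_trans (divergence_ge t0 dp0 dq) _.
  by apply: ereal_sup_ubound; exists q.
move: xlt; rewrite xE lnE -EFinM.
case sE : (ereal_sup _) lower => [s| |//] _; last by rewrite addye// ltNge leey.
rewrite -EFinD lte_fin mulrN => slt.
exists K, s, (fine (pi K)); split => //; last exact: ltW.
by move=> h Kh; rewrite -sE; apply: ereal_sup_ubound; exists h.
Qed.

Lemma prior_divergence_ge (t : R) (p0 : T -> R) n :
  is_density mu p0 -> (0 < t)%R ->
  (- t^-1)%:E <= prior_divergence mu pi PP t p0 n.
Proof.
move=> dp0 t0; apply/ereal_infP => _ [K [mK KPP K0 ->]].
have [Ke|/set0P[q Kq]] := eqVneq K set0.
  by move: K0; rewrite Ke measure0 ltxx.
have dq : is_density mu q by case: pi_prior => _ _ + _; apply; exact: KPP.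
rewrite -[leLHS]adde0; apply: leeD.
  apply: le_trans (divergence_ge t0 dp0 dq) _.
  by apply: ereal_sup_ubound; exists q.
rewrite mule_ge0 ?lee_fin ?invr_ge0// lne_ge0 inve_ge1//.
exact: probability_le1.
Qed.

(** Evaluation extended by 0 outside PP, which makes it nonnegative and jointly measurable on the
    whole product. *)
Let e (f : g_sigma_algebraType G) (y : T) : R :=
  ((fun z : g_sigma_algebraType G * T => (z.1 : T -> R) z.2) \_ (PP `*` setT)) (f, y).

Let eE f : PP f -> e f = f.
Proof. by move=> Pf; apply/funext => y; rewrite /e patchE mem_set. Qed.

Let me : measurable_fun setT (fun z : g_sigma_algebraType G * T => e z.1 z.2).
Proof.
have -> : (fun z : g_sigma_algebraType G * T => e z.1 z.2) =
    (fun z => (z.1 : T -> R) z.2) \_ (PP `*` setT) by apply/funext => -[].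
apply/measurable_restrict => //; first exact: measurableX.
by rewrite setTI; case: pi_prior.
Qed.

Let e_ge0 f y : (0 <= e f y)%R.
Proof.
rewrite /e patchE; case: ifPn => //; rewrite inE => -[/= Pf _].
by case: pi_prior => _ _ /(_ _ Pf) [].
Qed.

(** On PP the divergence is an affine function of an affinity whose kernel vanishes where p0 does,
    so [measurable_integral_density] applies. *)
Lemma measurable_divergence_gt (u x : R) (p0 : T -> R) :
  (0 < u)%R -> (u < 1)%R -> is_density mu p0 ->
  G.-sigma.-measurable (PP `&` [set f | x%:E < divergence mu (- u) p0 f]).
Proof.
move=> u0 u1 dp0; have [mp0 p0_ge0 _] := dp0.
pose D (f : g_sigma_algebraType G) := ((- u)^-1)%:E *
  (\int[mu]_y (p0 y `^ (1 - u) * e f y `^ u)%:E - 1).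
have mD : measurable_fun setT D.
  apply: emeasurable_funM => //; apply: emeasurable_funB => //.
  apply: (measurable_integral_density dp0 (F := fun z : g_sigma_algebraType G * T =>
    (p0 z.2 `^ (1 - u) * e z.1 z.2 `^ u)%:E)) => //.
  - apply/measurable_EFinP; apply: measurable_funM.
      apply: (measurableT_comp (measurable_powR _)).
      exact: measurableT_comp mp0 measurable_snd.
    exact: (measurableT_comp (measurable_powR _)).
  - by move=> z; rewrite lee_fin mulr_ge0 ?powR_ge0.
  - by move=> f y ->; rewrite powR0 ?mul0r// subr_eq0 gt_eqF.
have -> : PP `&` [set f | x%:E < divergence mu (- u) p0 f] =
    PP `&` D @^-1` `]x%:E, +oo].
  have dD f : PP f -> divergence mu (- u) p0 f = D f.
    move=> Pf; have df : is_density mu f by case: pi_prior => _ _ + _; apply.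
    by rewrite /D (eE Pf); exact: divergence_opp.
  apply/seteqP; split => f [Pf] /=; rewrite in_itv/= leey andbT dD//.
apply: measurableI => //; rewrite -[X in measurable X]setTI.
by apply: mD => //; exact: emeasurable_itv.
Qed.

Lemma posterior_divergence_gt (u t eps : R) (p0 : T -> R) n :
  (0 < u)%R -> (u < 1)%R -> (0 < t)%R -> (0 < n)%N -> is_density mu p0 ->
  prior_divergence mu pi PP t p0 n
    + (n%:R^-1)%:E * lne (norm_complexity mu pi PP u n
                          * (n%:R `^ (2 * (u^-1 + t^-1)))%:E) = eps%:E ->
  sample_integral mu (fun Y : n.-tuple T =>
    posterior pi PP (PP `&` [set f | eps%:E < divergence mu (- u) p0 f]) Y
    * (likelihood p0 Y)%:E)
  <= ((expR (2 * u * ln 2 + u + 2) + 2) * n%:R ^- 2)%:E.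
Proof.
move=> u0 u1 t0 n0 dp0 epsE.
have nR : (0 < n%:R :> R)%R by rewrite ltr0n.
set A : set (g_sigma_algebraType G) := PP `&` _.
have mA : measurable A.
  exact: measurable_divergence_gt.
have APP : A `<=` PP by move=> f [].
have N1 := norm_complexity_ge1 n u0 (ltW u1).
have powN0 : (0 < n%:R `^ (2 * (u^-1 + t^-1)))%R by rewrite powR_gt0.
have vlow : (- t^-1)%:E <= prior_divergence mu pi PP t p0 n.
  exact: prior_divergence_ge.
(* An infinite complexity would make the threshold +oo, because the prior divergence is not -oo. *)
have [N NE] : exists N, norm_complexity mu pi PP u n = N%:E.
  move: epsE N1; case: (norm_complexity _ _ _ _ _) => [N _ _|+ _|//].
    by exists N.
  rewrite gt0_mulye ?lte_fin//= gt0_muley ?lte_fin ?invr_gt0//.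
  by case: (prior_divergence _ _ _ _ _ _) vlow => //= ? _; rewrite addey.
have {}N1 : (1 <= N)%R by rewrite -lee_fin -NE.
have N0 : (0 < N)%R by exact: lt_le_trans ltr01 N1.
have [v vE epsE'] : exists2 v, prior_divergence mu pi PP t p0 n = v%:E &
    eps = (v + n%:R^-1 * (ln N + 2 * (u^-1 + t^-1) * ln n%:R))%R.
  move: epsE vlow; rewrite NE -EFinM lne_EFin ?mulr_gt0//.
  rewrite lnM ?posrE// ln_powR -EFinM.
  by case: (prior_divergence _ _ _ _ _ _) => // v [<-] _; exists v.
have [K [s [kappa [[mK KPP k0 kE] hK hs]]]] := prior_divergence_near dp0 n0 t0 vE.
have [B [mB BPP coverB diam sumB]] := norm_complexity_cover u0 (ltW u1) NE.
pose M := (2 * expR (2 / t * ln n%:R + n%:R * s) / kappa)%R.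
have M0 : (0 < M)%R by rewrite /M divr_gt0// mulr_gt0// expR_gt0.
pose C : nat -> set (g_sigma_algebraType G) := seqDU (fun j => A `&` B j).
have mAB j : measurable (A `&` B j : set (g_sigma_algebraType G)) by exact: measurableI.
have mC j : measurable (C j) by exact: seqDU_measurable.
have CAB j : C j `<=` A `&` B j by exact: subset_seqDU.
have CA j : C j `<=` A by move=> f /CAB [].
have CU : \bigcup_j C j = A.
  rewrite -seqDU_bigcup_eq -setI_bigcupr; apply/setIidPl.
  by move=> f /APP /coverB.
have likE (S : set (T -> R)) (Y : n.-tuple T) : S `<=` PP ->
    marginal_likelihood pi S Y = \int[pi]_(f in S) (likelihood (e f) Y)%:E.
  move=> SPP; apply: eq_integral => f; rewrite inE => /SPP Pf.
  by rewrite eE.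
apply: (@le_trans _ _ (sample_integral mu (fun Y : n.-tuple T =>
    (\int[pi]_(f in \bigcup_j C j) (likelihood (e f) Y)%:E /
     \int[pi]_(f in PP) (likelihood (e f) Y)%:E) * (likelihood p0 Y)%:E))).
  rewrite CU le_eqVlt; apply/orP; left; apply/eqP; congr sample_integral.
  by apply/funext => Y; rewrite /posterior !likE.
(* A member f0 of A is what shows 1 - u eps >= 0: its affinity with p0 is nonnegative and at most 1
   - u eps. *)
have [Aempty|/set0P [f0 Af0]] := eqVneq A set0.
  rewrite CU Aempty (_ : (fun Y => _) = fun=> 0); last first.
    by apply/funext => Y; rewrite integral_set0 !mul0e.
  by rewrite sample_integral0 lee_fin mulr_ge0 ?addr_ge0 ?expR_ge0//.
have a0 : (0 <= 1 - u * eps)%R.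
  have [Pf0 f0eps] := Af0.
  have df0 : is_density mu f0 by case: pi_prior => _ _ + _; apply.
  have := divergence_opp_gt u0 u1 dp0 df0 f0eps.
  rewrite -lee_fin; apply: le_trans; apply: integral_ge0 => y _.
  by rewrite lee_fin mulr_ge0 ?powR_ge0.
have r0 : (0 < n%:R `^ (- u^-1) :> R)%R by rewrite powR_gt0.
have eta0 : (0 < 2 * n%:R `^ (- u^-1) :> R)%R by rewrite mulr_gt0.
have := @posterior_expectation _ _ _ mu p0 dp0 _ _ pi e me e_ge0
  u t kappa M (1 - u * eps)%R (2 * n%:R `^ (- u^-1))%R (expR (t * s)) PP K C n
  u0 u1 t0 M0 k0 kE mPP mK KPP mC (fun j => subset_trans (CA j) APP)
  (trivIset_seqDU _) a0 eta0 (expR_ge0 _).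
move/(_ _ _ _)/le_trans; apply.
- move=> j f /CA [Pf feps]; rewrite eE//.
  have df : is_density mu f by case: pi_prior => _ _ + _; apply.
  exact: divergence_opp_gt.
- move=> j f g /CAB [[Pf _] Bf] /CAB [[Pg _] Bg]; rewrite !eE//.
  exact: diam Bf Bg.
- move=> f Kf; rewrite eE; last exact: KPP.
  have df : is_density mu f by case: pi_prior => _ _ + _; apply; exact: KPP.
  by apply: divergence_pos_le => //; exact: hK.
(* The radius n^(-1/u) is made for this step: the u-th power of the diameter is 2^u / n <= 2 / n,
   and its n-th power effect stays bounded. *)
have rho : (1 - u * eps + (2 * n%:R `^ (- u^-1)) `^ u <=
            expR (- (u * eps) + 2 / n%:R))%R.
  apply: le_trans (expR_ge1Dx _); rewrite addrA lerD2l.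
  rewrite powRM// -powRrM mulNr mulVf ?gt_eqF// powR_inv1//.
  by rewrite ler_pM2r ?invr_gt0// ler1_powR ?ler1n// ltW.
have sumC : \sum_(j <oo) pi (C j) `^ u <= ((2 * N) `^ u)%:E.
  apply: le_trans sumB; apply: lee_nneseries => [j _ _|j _]; first exact: poweR_ge0.
  apply: gt0_ler_poweR; rewrite ?(ltW u0)// ?in_itv/= ?leey ?andbT//.
  by apply: le_measure; rewrite ?inE// => f /CAB [].
have eta_u0 : (0 <= 1 - u * eps + (2 * n%:R `^ (- u^-1)) `^ u)%R.
  by rewrite addr_ge0 ?powR_ge0.
apply: le_trans (leeD (lee_wpmul2l _ sumC) (lexx _)) _.
  by rewrite lee_fin mulr_ge0 ?powR_ge0 ?exprn_ge0.
rewrite -EFinM -EFinD lee_fin.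
apply: le_trans (inverse_square_bound n0 u0 t0 k0 N0 hs epsE' (erefl M)).
rewrite lerD2r; apply: ler_wpM2r; first exact: powR_ge0.
apply: ler_wpM2l; first exact: powR_ge0.
by apply: lerXn2r; rewrite ?nnegrE ?expR_ge0.
Qed.

End prior.

(** * Conclusion by Borel-Cantelli *)

Theorem mainTheorem5 (R : realType) (d : measure_display) (T : measurableType d)
    (mu : {measure set T -> \bar R}) (p0 : T -> R)
    (G : set (set (T -> R))) (pi : probability (g_sigma_algebraType G) R)
    (PP : set (T -> R))
    (d' : measure_display) (Omega : measurableType d') (Pr : probability Omega R)
    (p : nat -> Omega -> T -> R) (u t : R)
    (p0_density : is_density mu p0)
    (pi_prior : prior_on mu pi PP)
    (p_posterior : posterior_sequence mu pi PP p0 Pr p)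
    (u_inv : exists m : nat, (2 <= m)%N /\ u = (m%:R^-1)%R)
    (t_gt0 : (0 < t)%R) :
  {ae Pr, forall w, \forall n \near \oo,
    divergence mu (- u) p0 (p n w) <=
      prior_divergence mu pi PP t p0 n
      + (n%:R^-1)%:E * lne (norm_complexity mu pi PP u n
                            * (n%:R `^ (2 * (u^-1 + t^-1)))%:E)}.
Proof.
have u0 : (0 < u)%R.
  by case: u_inv => m [m2 ->]; rewrite invr_gt0 ltr0n (leq_trans _ m2).
have u1 : (u < 1)%R.
  case: u_inv => m [m2 ->].
  by rewrite invf_lt1 ?ltr1n// ltr0n (leq_trans _ m2).
pose thr n := prior_divergence mu pi PP t p0 n
  + (n%:R^-1)%:E * lne (norm_complexity mu pi PP u n
                        * (n%:R `^ (2 * (u^-1 + t^-1)))%:E).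
pose bad n := PP `&` [set f | thr n < divergence mu (- u) p0 f].
(* The posterior law is specified for n > 0 only, so the event at 0 is set to be empty. *)
pose F n := if n is 0%N then set0 else p n @^-1` bad n.
pose c := (expR (2 * u * ln 2 + u + 2) + 2)%R.
have c0 : (0 <= c)%R by rewrite addr_ge0 ?expR_ge0.
have key n : (0 < n)%N -> measurable (F n) /\ Pr (F n) <= (c * n%:R ^- 2)%:E.
  move=> n0; have -> : F n = p n @^-1` bad n by rewrite /F; case: n n0.
  have [_ Pp mp Prp] := p_posterior n n0.
  have nR : (0 < n%:R :> R)%R by rewrite ltr0n.
  have thr_low : thr n != -oo.
    have powN1 : (1 <= n%:R `^ (2 * (u^-1 + t^-1)))%R.
      rewrite -[leLHS](powRr0 n%:R); apply: ler_powR; rewrite ?ler1n//.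
      by rewrite mulr_ge0// addr_ge0// invr_ge0 ltW.
    have Nge1 : 1 <= norm_complexity mu pi PP u n *
        (n%:R `^ (2 * (u^-1 + t^-1)))%:E.
      rewrite -[leLHS]mule1; apply: lee_pmul => //.
      exact: (norm_complexity_ge1 pi_prior n u0 (ltW u1)).
    rewrite -ltNye; apply: lt_le_trans (ltNyr (- t^-1)) _.
    rewrite -[leLHS]adde0; apply: leeD.
      exact: prior_divergence_ge.
    by apply: mule_ge0; rewrite ?lne_ge0// lee_fin invr_ge0 ltW.
  have badPP : bad n `<=` PP by move=> f [].
  (* An infinite threshold cannot be exceeded, so the bad set is then empty. *)
  case thrE : (thr n) thr_low => [eps| |//] _; last first.
    have -> : bad n = set0.
      by apply/seteqP; split => // f [_ /=]; rewrite thrE ltNge leey.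
    rewrite preimage_set0 measure0; split => //.
    by rewrite lee_fin mulr_ge0// invr_ge0 exprn_ge0.
  have badE : bad n = PP `&` [set f | eps%:E < divergence mu (- u) p0 f].
    by rewrite /bad thrE.
  have mbad : G.-sigma.-measurable (bad n).
    by rewrite badE; exact: (measurable_divergence_gt pi_prior eps u0 u1 p0_density).
  split; first by rewrite -[X in measurable X]setTI; exact: mp.
  rewrite Prp// badE.
  exact: (posterior_divergence_gt pi_prior u0 u1 t_gt0 n0 p0_density thrE).
have mF n : measurable (F n).
  by case: n => [|n]; [exact: measurable0|exact: (key n.+1 isT).1].
have PrF n : Pr (F n) <= (c * n%:R ^- 2)%:E.
  case: n => [|n]; last exact: (key n.+1 isT).2.
  by rewrite measure0 lee_fin mulr_ge0// invr_ge0 exprn_ge0.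
have sumF : \sum_(n <oo) Pr (F n) < +oo.
  apply: (@le_lt_trans _ _ (c * 2)%:E); last exact: ltry.
  apply: lime_le; first by apply: is_cvg_nneseries => n _ _; exact: measure_ge0.
  apply: nearW => n.
  apply: (@le_trans _ _ (\sum_(0 <= k < n) (c * k%:R ^- 2)%:E)).
    by apply: lee_sum => k _.
  rewrite sumEFin lee_fin -mulr_sumr ler_wpM2l//.
  exact: sum_inv_sqr_le.
(* By Borel-Cantelli, the event that infinitely many F n occur is null; outside it the bound holds
   eventually. *)
exists (lim_sup_set F); split.
- by apply: bigcap_measurable => // n _; apply: bigcup_measurable.
- exact: lim_sup_set_cvg0.
move=> w /= nw; apply: contrapT => nlim; apply: nw.
have [m Fm] : exists m, forall j, (m <= j)%N -> ~ F j w.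
  apply: contrapT => /forallNP h; apply: nlim => m _.
  have [j /not_implyP[mj /contrapT Fj]] := (existsNP _).2 (h m).
  by exists j.
(* Starting at m + 1 rather than m guarantees n > 0, where F n is the actual bad event. *)
exists m.+1 => // n /= mn.
have n0 : (0 < n)%N by exact: leq_ltn_trans mn.
have := Fm n (ltnW mn); rewrite /F; case: n n0 mn => // n n0 mn nbad.
have [_ Pp _ _] := p_posterior n.+1 isT.
rewrite leNgt; apply/negP => lt_div; apply: nbad.
by split => //; exact: Pp.
Qed.
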